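(* For every $g\ge1$ there is no non-vanishing cusp form in $[\Gamma_g[2],2]$.
   Context: $\Gamma_g[2]=\ker(\mathrm{Sp}(g,\mathbb Z)\to\mathrm{Sp}(g,\mathbb Z/2\mathbb Z))$ acts on the Siegel half space $\mathcal H_g$ by $M\tau=(A\tau+B)(C\tau+D)^{-1}$. $[\Gamma_g[2],2]$ is the space of Siegel modular forms of weight $2$ on $\Gamma_g[2]$ with trivial character: holomorphic $f$ on $\mathcal H_g$ with $f(M\tau)=\det(C\tau+D)^2f(\tau)$ for all $M\in\Gamma_g[2]$ (with the usual regularity at the cusps when $g=1$). A cusp form is such an $f$ vanishing at all cusps (equivalently, for every $M\in\mathrm{Sp}(g,\mathbb Z)$ the Fourier expansion of $\det(C\tau+D)^{-2}f(M\tau)$ involves only positive definite $T$). *)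

(* Defs.v *)
From HB Require Import structures.
From mathcomp Require Import all_boot all_order all_algebra.
From mathcomp Require Import finmap.
From mathcomp Require Import all_classical all_reals all_analysis.
From mathcomp Require summability.
From mathcomp Require Import complex.

Set Implicit Arguments.
Unset Strict Implicit.
Unset Printing Implicit Defensive.

Import Order.TTheory GRing.Theory Num.Theory.
Import numFieldNormedType.Exports.

Local Open Scope classical_set_scope.
Local Open Scope complex_scope.
Local Open Scope ring_scope.

(* R[i] as a normed space over itself, hence the usual topologies on R[i] and on
   matrices over R[i]; differentiable then means complex differentiable. *)
HB.instance Definition _ (R : rcfType) := NormedModule.copy R[i] (R[i])^o.

Definition cexp (R : realType) (z : R[i]) : R[i] :=
  (expR (complex.Re z))%:C
    * (cos (complex.Im z) +i* sin (complex.Im z)).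

Definition posdef (R : realType) (g : nat) (Y : 'M[R]_g) : Prop :=
  Y^T = Y /\ forall v : 'rV[R]_g, v != 0 -> 0 < (v *m Y *m v^T) 0 0.

Definition possemidef (R : realType) (g : nat) (Y : 'M[R]_g) : Prop :=
  Y^T = Y /\ forall v : 'rV[R]_g, 0 <= (v *m Y *m v^T) 0 0.

Definition siegel_space (R : realType) (g : nat) : set 'M[R[i]]_g :=
  [set tau | tau^T = tau /\ posdef (map_mx (@complex.Im R) tau)].

Definition symplectic_form (g : nat) : 'M[int]_(g + g) :=
  block_mx 0 1%:M (- 1%:M) 0.

Definition Sp_int (g : nat) : set 'M[int]_(g + g) :=
  [set M | M^T *m symplectic_form g *m M = symplectic_form g].

Definition Gamma2 (g : nat) : set 'M[int]_(g + g) :=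
  [set M | Sp_int M /\ map_mx (fun z : int => z%:~R : 'F_2) M = 1%:M].

Definition mx_int_to_C (R : realType) (m n : nat) (A : 'M[int]_(m, n)) :
    'M[R[i]]_(m, n) :=
  map_mx (fun z : int => z%:~R) A.

Definition automorphy_mx (R : realType) (g : nat) (M : 'M[int]_(g + g))
    (tau : 'M[R[i]]_g) : 'M[R[i]]_g :=
  mx_int_to_C R (dlsubmx M) *m tau + mx_int_to_C R (drsubmx M).

Definition siegel_act (R : realType) (g : nat) (M : 'M[int]_(g + g))
    (tau : 'M[R[i]]_g) : 'M[R[i]]_g :=
  (mx_int_to_C R (ulsubmx M) *m tau + mx_int_to_C R (ursubmx M))
    *m invmx (automorphy_mx M tau).

Definition slash (R : realType) (g k : nat) (M : 'M[int]_(g + g))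
    (f : 'M[R[i]]_g -> R[i]) (tau : 'M[R[i]]_g) : R[i] :=
  \det (automorphy_mx M tau) ^- k * f (siegel_act M tau).

(* The symmetric matrix whose entries on and above the diagonal are those of
   X. The entries of X with i <= j are the coordinates of the space of
   symmetric matrices, in which the Siegel half space is open. *)
Definition sym_of_upper (R : realType) (g : nat) (X : 'M[R[i]]_g) :
    'M[R[i]]_g :=
  \matrix_(i, j) if (i <= j)%N then X i j else X j i.

(* Complex differentiability of f at every point of the half space, as a
   function of the g(g+1)/2 variables tau i j with i <= j; the composition with
   sym_of_upper does not depend on the other entries, and the values of f
   outside the half space are irrelevant. *)
Definition siegel_holomorphic (R : realType) (g : nat)
    (f : 'M[R[i]]_g -> R[i]) : Prop :=
  forall tau, siegel_space tau ->
    differentiable (fun X : 'M[R[i]]_g => f (sym_of_upper X)) tau.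

Definition half_integral (R : realType) (g : nat) (T : 'M[R]_g) : Prop :=
  [/\ T^T = T, forall i, T i i \is a Num.int
    & forall i j, 2 * T i j \is a Num.int].

(* Gamma2 g contains the translations tau |-> tau + 2 S with S integral
   symmetric, whence the characters exp (pi i tr (T tau)) with T half-integral.
   The series is summed unconditionally (along the finite subsets of the index
   type), and its terms vanish off the half-integral matrices. *)
Definition fourier_expansion (R : realType) (g : nat)
    (h : 'M[R[i]]_g -> R[i]) (a : 'M[R]_g -> R[i]) : Prop :=
  (forall T, a T != 0 -> half_integral T) /\
  (forall tau, siegel_space tau ->
    summability.partial_sum (fun T : 'M[R]_g =>
        a T * cexp ((0 +i* pi) * \tr (map_mx (real_complex R) T *m tau)))
      @ summability.totally --> h tau).

(* Gamma2 g is normal in Sp(g,Z), so the transforms of f by all of Sp(g,Z) have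
   expansions of the same shape; these are the expansions at the cusps. *)
Definition regular_at_cusps (R : realType) (g k : nat)
    (f : 'M[R[i]]_g -> R[i]) : Prop :=
  forall M, Sp_int M -> exists a : 'M[R]_g -> R[i],
    fourier_expansion (slash k M f) a /\ forall T, a T != 0 -> possemidef T.

Definition vanishes_at_cusps (R : realType) (g k : nat)
    (f : 'M[R[i]]_g -> R[i]) : Prop :=
  forall M, Sp_int M -> exists a : 'M[R]_g -> R[i],
    fourier_expansion (slash k M f) a /\ forall T, a T != 0 -> posdef T.

Definition modular_form_Gamma2 (R : realType) (g k : nat)
    (f : 'M[R[i]]_g -> R[i]) : Prop :=
  [/\ siegel_holomorphic f,
      forall M tau, Gamma2 M -> siegel_space tau ->
        f (siegel_act M tau) = \det (automorphy_mx M tau) ^+ k * f tau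
    & g = 1%N -> regular_at_cusps k f].

Definition cusp_form_Gamma2 (R : realType) (g k : nat)
    (f : 'M[R[i]]_g -> R[i]) : Prop :=
  modular_form_Gamma2 k f /\ vanishes_at_cusps k f.

(* Main.v *)
(** Let [a_M(T)] be the Fourier coefficients of [f|M], [M] in Sp(g,Z); they are supported on
    positive definite [T] and, up to finitely many possibilities, do not depend on [M]. Suppose
    some coefficient is nonzero, choose [(M, T0)] with [a_M(T0) <> 0] and [det T0] minimal, and
    let [T'] be the lower right block of [T0] of size [g - 1]. Put
      [tau = W diag(t, i) W^T + [[0, m], [m^T, X]]], [W = [[1, 0], [l^T, 1]]]
    in [f|M]; the coefficient of [T'] with respect to [X] is, up to a constant factor,
      [J_M(l, m, t) = \sum_T a_M(T) exp(pi i (T(1, l) t + 2 r m^T))],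
    the sum being over the [T] with lower right block [T'], where [r] is the upper right block
    and [T(1, l)] the value of the quadratic form. The height [Im t |J_M|] is invariant under
    SL(2,Z) acting on [t] and [(l, m)] and permuting the [M], and therefore bounded. Completing
    the square, minimality of [det T0] yields [T(1, l) >= delta := det T0 / det T'].

    If [g <= 5], reduction theory for quadratic forms lets us assume [delta >= 25/64]. At points
    with [Im t >= 433/500] the maximum principle on horizontal lines then improves every bound
    of the height by a constant factor [< 1], so [J_M = 0]. The maximum principle only needs
    rational [l], for which [J_M] is a power series in [exp(pi i t / q)].

    If [g >= 6], the coefficients at the [N^(g-1)] forms obtained from [T0] by the shears
    [l |-> l + 2 k], [0 <= k_j < N], are equal, and Bessel's inequality at [l = 0],
    [Im t = N^-2] bounds [N^(g-1) |a_M(T0)|^2] by a multiple of [N^4]; hence [a_M(T0) = 0]. *)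
Require Import Defs.
From HB Require Import structures.
From mathcomp Require Import all_boot all_order all_algebra.
From mathcomp Require Import finmap.
From mathcomp Require Import all_classical all_reals all_analysis.
From mathcomp Require summability.
From mathcomp Require Import complex.
From mathcomp Require Import zify ring lra.

Set Implicit Arguments.
Unset Strict Implicit.
Unset Printing Implicit Defensive.

Import Order.TTheory GRing.Theory Num.Theory.
Import numFieldNormedType.Exports.
Import Normc.

Local Open Scope classical_set_scope.
Local Open Scope complex_scope.
Local Open Scope ring_scope.


(** * Unconditional sums *)

Section Modulus.
Variable R : realType.
Implicit Types (z w : R[i]) (x : R).

Lemma normc_ge0 z : 0 <= normc z.
Proof. by case: z => a b; rewrite /normc sqrtr_ge0. Qed.

Lemma normE z : `|z| = (normc z)%:C.
Proof. by case: z => a b; rewrite normc_def. Qed.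

Lemma normcB z w : normc (z - w) = normc (w - z).
Proof. by rewrite -normcN opprB. Qed.

Lemma normc_real x : normc x%:C = `|x|.
Proof. by rewrite /normc /= expr0n addr0 sqrtr_sqr. Qed.

Lemma normcX z n : normc (z ^+ n) = normc z ^+ n.
Proof.
elim: n => [|n IH]; first by rewrite !expr0 normc1.
by rewrite !exprS normcM IH.
Qed.

Lemma normc_sum (I : Type) (r : seq I) (P : pred I) (F : I -> R[i]) :
  normc (\sum_(i <- r | P i) F i) <= \sum_(i <- r | P i) normc (F i).
Proof.
elim/big_ind2 : _ => [|z x w y zx wy|//]; first by rewrite normc0.
exact: (le_trans (le_normcD _ _) (lerD zx wy)).
Qed.

Lemma normc_Re z : `|complex.Re z| <= normc z.
Proof.
by case: z => a b /=; rewrite -sqrtr_sqr ler_wsqrtr// lerDl sqr_ge0.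
Qed.

Lemma normc_Im z : `|complex.Im z| <= normc z.
Proof.
by case: z => a b /=; rewrite -sqrtr_sqr ler_wsqrtr// lerDr sqr_ge0.
Qed.

Lemma normc_le_ReIm z : normc z <= `|complex.Re z| + `|complex.Im z|.
Proof.
rewrite [in leLHS](complexE z) (le_trans (le_normcD _ _))// normcM !normc_real.
have -> : normc ('i%C : R[i]) = 1.
  by rewrite /normc expr0n expr1n add0r sqrtr1.
by rewrite mul1r.
Qed.

Lemma normc_mul_conjc z : (normc z ^+ 2)%:C = z * conjc z.
Proof. by rewrite rmorphXn /= -normE; exact: sqr_normc. Qed.

Lemma real_complexB x y : (x - y)%:C = x%:C - y%:C.
Proof. exact: rmorphB. Qed.

Lemma real_complexM x y : (x * y)%:C = x%:C * y%:C.
Proof. exact: rmorphM. Qed.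

Lemma real_complex_sum (I : Type) (r : seq I) (P : pred I) (F : I -> R) :
  (\sum_(i <- r | P i) F i)%:C = \sum_(i <- r | P i) (F i)%:C.
Proof. exact: rmorph_sum. Qed.

Lemma real_complex_nat n : (n%:R : R)%:C = n%:R.
Proof. exact: rmorph_nat. Qed.

End Modulus.

Section Families.
Variables (R : realType) (K : choiceType).
Implicit Types (c d : K -> R[i]) (s : R[i]) (F : {fset K}).

Definition has_sum c s :=
  forall e : R, 0 < e -> exists F0, forall F, (F0 `<=` F)%fset ->
    normc (\sum_(i <- F) c i - s) < e.

Definition abs_bounded c (B : R) := forall F, \sum_(i <- F) normc (c i) <= B.

Lemma has_sumP c s :
  summability.partial_sum c @ summability.totally --> s -> has_sum c s.
Proof.
move=> /cvgrPdist_lt cs e e0.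
have eC : (0 : R[i]) < e%:C by rewrite ltcR.
have [F0 _ F0P] := cs (@summability.totally_filter K) _ eC; exists F0 => F F0F; have := F0P F F0F.
by rewrite normE ltcR normcB /summability.partial_sum big_seq_fsetE.
Qed.

Lemma has_sumD c d s s' : has_sum c s -> has_sum d s' ->
  has_sum (fun k => c k + d k) (s + s').
Proof.
move=> cs cs' e e0.
have e20 : 0 < e / 2 by rewrite divr_gt0.
have [F0 h0] := cs _ e20; have [F1 h1] := cs' _ e20.
exists (F0 `|` F1)%fset => F; rewrite fsubUset => /andP[/h0 k0 /h1 k1].
rewrite big_split/= opprD addrACA (le_lt_trans (le_normcD _ _))//.
by rewrite [ltRHS]splitr ltrD.
Qed.

Lemma has_sumZ c s a : has_sum c s -> has_sum (fun k => a * c k) (a * s).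
Proof.
move=> cs e e0; have a1 : 0 < normc a + 1 by rewrite ltr_wpDl// normc_ge0.
have e1 : 0 < e / (normc a + 1) by rewrite divr_gt0.
have [F0 h0] := cs _ e1; exists F0 => F /h0 k0; rewrite -mulr_sumr -mulrBr normcM.
apply: (@le_lt_trans _ _ ((normc a + 1) * normc (\sum_(i <- F) c i - s))).
  by rewrite ler_wpM2r ?normc_ge0// lerDl.
by rewrite mulrC -ltr_pdivlMr.
Qed.

Lemma has_sumB c d s s' : has_sum c s -> has_sum d s' ->
  has_sum (fun k => c k - d k) (s - s').
Proof.
move=> cs /(has_sumZ (-1)) ds; have := has_sumD cs ds; rewrite mulN1r.
by congr has_sum; apply/funext => k; rewrite mulN1r.
Qed.

Lemma has_sum_le c s B : abs_bounded c B -> has_sum c s -> normc s <= B.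
Proof.
move=> cB cs; apply/ler_addgt0Pl => e e0.
have [F0 /(_ F0 (fsubset_refl _)) h0] := cs _ e0.
rewrite -(subrK (\sum_(i <- F0) c i) s) (le_trans (le_normcD _ _))//.
rewrite lerD//; first by rewrite normcB ltW.
exact: le_trans (normc_sum _ _ _) (cB F0).
Qed.

Lemma sum_nneg_sub (x : K -> R) F F' : (F `<=` F')%fset -> (forall k, 0 <= x k) ->
  \sum_(i <- F) x i <= \sum_(i <- F') x i.
Proof.
move=> FF' x0; rewrite [leRHS](big_fsetID _ (mem F))/= .
have -> : [fset x0 in F' | x0 \in F]%fset = F.
  apply/fsetP => k; rewrite !inE andbC; case: (boolP (k \in F)) => //= kF.
  by rewrite (fsubsetP FF').
by rewrite lerDl sumr_ge0.
Qed.

Lemma abs_boundedW c d B : (forall k, normc (d k) <= normc (c k)) ->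
  abs_bounded c B -> abs_bounded d B.
Proof. by move=> dc cB F; apply: le_trans (cB F); apply: ler_sum. Qed.

Lemma abs_bounded_ge0 c B : abs_bounded c B -> 0 <= B.
Proof. by move=> /(_ fset0); rewrite big_seq_fset0. Qed.

Lemma abs_bounded_tail c B e : abs_bounded c B -> 0 < e ->
  exists F0, forall F, \sum_(i <- F | i \notin F0) normc (c i) <= e.
Proof.
move=> cB e0; pose E := [set x | exists F, x = \sum_(i <- F) normc (c i)]%classic.
have hE : has_sup E.
  split; first by exists (\sum_(i <- fset0) normc (c i)); exists fset0.
  by exists B => _ [F ->].
have [_ [F0 ->] h] := sup_adherent e0 hE; exists F0 => F.
have : \sum_(i <- (F0 `|` F)%fset) normc (c i) <= sup E.
  by apply: ub_le_sup; [case: hE | exists ((F0 `|` F)%fset)].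
rewrite (big_fsetID _ (mem F0))/=.
have -> : [fset x in (F0 `|` F)%fset | x \in F0]%fset = F0.
  by apply/fsetP => k; rewrite !inE; case: (k \in F0) => //=; rewrite andbF.
have -> : \sum_(i <- [fset x in (F0 `|` F)%fset | x \notin F0]%fset) normc (c i) =
          \sum_(i <- F | i \notin F0) normc (c i).
  rewrite [RHS]big_fset_condE; apply: eq_fbigl => k; rewrite !inE.
  by case: (k \in F0) => //=; rewrite ?andbF ?andbT.
move: h; set x := \sum_(i <- F0) _; set y := \sum_(i <- F | _) _; lra.
Qed.

Lemma has_sum_nneg (x : K -> R) B : (forall k, 0 <= x k) ->
  (forall F, \sum_(i <- F) x i <= B) -> exists s, has_sum (fun k => (x k)%:C) s.
Proof.
move=> x0 xB; pose E := [set y | exists F, y = \sum_(i <- F) x i]%classic.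
have hE : has_sup E.
  split; first by exists (\sum_(i <- fset0) x i); exists fset0.
  by exists B => _ [F ->].
exists (sup E)%:C => e e0.
have [_ [F0 ->] h] := sup_adherent e0 hE; exists F0 => F F0F.
rewrite -real_complex_sum -real_complexB normc_real ler0_norm.
  rewrite opprB ltrBlDr -ltrBlDl (lt_le_trans h)//.
  exact: sum_nneg_sub.
by rewrite subr_le0; apply: ub_le_sup; [case: hE | exists F].
Qed.

Lemma abs_bounded_has_sum c B : abs_bounded c B -> exists s, has_sum c s.
Proof.
move=> cB.
have bnd (p : R[i] -> R) : (forall z, `|p z| <= normc z) ->
    exists s, has_sum (fun k => (p (c k))%:C) s.
  move=> pz.
  have [k|F|s hs] := @has_sum_nneg (fun k => p (c k) + `|p (c k)|) (B + B).
  - by rewrite -lerBlDl sub0r; have := ler_norm (- p (c k)); rewrite normrN.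
  - rewrite (le_trans _ (lerD (cB F) (cB F)))// -big_split/= ler_sum// => k _.
    by rewrite lerD// (le_trans (ler_norm _)).
  have [//|F|s' hs'] := @has_sum_nneg (fun k => `|p (c k)|) B.
    by rewrite (le_trans _ (cB F))// ler_sum.
  exists (s - s'); have := has_sumB hs hs'.
  by congr has_sum; apply/funext => k; rewrite -real_complexB addrK.
have [s hs] := bnd (@complex.Re R) (@normc_Re R).
have [s' /(has_sumZ 'i%C) hs'] := bnd (@complex.Im R) (@normc_Im R).
exists (s + 'i%C * s'); have := has_sumD hs hs'.
by congr has_sum; apply/funext => k; rewrite -complexE.
Qed.

Lemma has_sum_bounded c s : has_sum c s -> exists B, abs_bounded c B.
Proof.
move=> cs; have [F0 h0] := cs _ ltr01.
have small (G : {fset K}) : (forall i, i \in G -> i \notin F0) ->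
    normc (\sum_(i <- G) c i) <= 2.
  move=> GF0; have /h0 k0 := fsubset_refl F0.
  have /h0 := fsubsetUl F0 G; rewrite (big_fsetID _ (mem F0))/=.
  have -> : [fset x in (F0 `|` G)%fset | x \in F0]%fset = F0.
    by apply/fsetP => k; rewrite !inE; case: (k \in F0) => //=; rewrite andbF.
  have -> : [fset x in (F0 `|` G)%fset | x \notin F0]%fset = G.
    apply/fsetP => k; rewrite !inE; have := GF0 k.
    by case: (k \in F0) => //=; case: (k \in G) => //= /(_ isT).
  set x := \sum_(i <- F0) _ in k0 *; set y := \sum_(i <- G) _ => k1.
  have -> : y = (x + y - s) - (x - s) by ring.
  by rewrite (le_trans (le_normcD _ _))// normcN -[leRHS]/(1 + 1 : R) lerD// ltW.
have half (p : {additive R[i] -> R}) (G : {fset K}) :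
    (forall z, `|p z| <= normc z) -> (forall i, i \in G -> i \notin F0) ->
    \sum_(i <- G) `|p (c i)| <= 4.
  move=> pz GF0; rewrite (bigID (fun i => 0 <= p (c i)))/=.
  have bd (P : pred K) : `|\sum_(i <- G | P i) p (c i)| <= 2.
    rewrite big_fset_condE -raddf_sum (le_trans (pz _))// small// => i.
    by rewrite !inE/= => /andP[/GF0].
  have -> : (4 : R) = 2 + 2 by ring.
  apply: lerD.
    under eq_bigr => i pi do rewrite ger0_norm//.
    exact: le_trans (ler_norm _) (bd _).
  under eq_bigr => i pi.
    rewrite -ltNge in pi; rewrite ltr0_norm//; over.
  by rewrite sumrN; apply: le_trans (ler_norm _) _; rewrite normrN bd.
have addRe : additive (@complex.Re R) by move=> [a b] [a' b'].
have addIm : additive (@complex.Im R) by move=> [a b] [a' b'].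
pose re : {additive R[i] -> R} := HB.pack (@complex.Re R)
  (GRing.isAdditive.Build _ _ _ addRe).
pose im : {additive R[i] -> R} := HB.pack (@complex.Im R)
  (GRing.isAdditive.Build _ _ _ addIm).
exists (\sum_(i <- F0) normc (c i) + 8) => F.
rewrite (big_fsetID _ (mem F0))/= lerD//.
  apply: sum_nneg_sub => [|k]; last exact: normc_ge0.
  by apply/fsubsetP => k; rewrite !inE => /andP[].
set G := [fset _ | _ in _ & _]%fset.
have GF0 i : i \in G -> i \notin F0 by rewrite !inE => /andP[].
have h1 := half re G (@normc_Re R) GF0.
have h2 := half im G (@normc_Im R) GF0.
have -> : (8 : R) = 4 + 4 by ring.
rewrite (le_trans _ (lerD h1 h2))// -big_split/= ler_sum// => k _.
exact: normc_le_ReIm.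
Qed.

Lemma has_sum_tail c s B F0 e : abs_bounded c B -> has_sum c s -> 0 < e ->
  (forall F, \sum_(i <- F | i \notin F0) normc (c i) <= e) ->
  forall F, (F0 `<=` F)%fset -> normc (s - \sum_(i <- F) c i) <= e.
Proof.
move=> cB cs e0 h F F0F; apply/ler_addgt0Pl => d d0.
have [F1 /(_ _ (fsubsetUl F1 F)) h1] := cs _ d0.
have -> : s - \sum_(i <- F) c i = (s - \sum_(i <- (F1 `|` F)%fset) c i) +
    \sum_(i <- (F1 `|` F)%fset | i \notin F) c i.
  rewrite [in RHS](big_fsetID _ (mem F))/=.
  have -> : [fset x in (F1 `|` F)%fset | x \in F]%fset = F.
    apply/fsetP => k; rewrite !inE; case: (k \in F) => //=; last by rewrite andbF.
    by rewrite orbT.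
  by rewrite -big_fset_condE; ring.
rewrite (le_trans (le_normcD _ _))// lerD//; first by rewrite normcB ltW.
rewrite (le_trans (normc_sum _ _ _))// (le_trans _ (h ((F1 `|` F)%fset)))//.
rewrite [leLHS]big_mkcond [leRHS]big_mkcond/= ler_sum// => k _.
case: ifP => // kF; last by case: ifP => // _; exact: normc_ge0.
by case: ifP => // /negbFE /(fsubsetP F0F); rewrite (negbTE kF).
Qed.

End Families.

Lemma has_sum_bij (R : realType) (K : choiceType) (f g : K -> K) (c : K -> R[i]) s :
  cancel f g -> cancel g f -> has_sum c s -> has_sum (c \o f) s.
Proof.
move=> fg gf cs e e0; have [F0 h] := cs _ e0.
exists [fset g k | k in F0]%fset => F gF.
have -> : \sum_(i <- F) (c \o f) i = \sum_(i <- [fset f k | k in F]%fset) c i.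
  by rewrite big_imfset//= => x y _ _ /(can_inj fg).
apply: h; apply/fsubsetP => k kF0; apply/imfsetP; exists (g k); last by rewrite gf.
by apply: (fsubsetP gF); apply/imfsetP; exists k.
Qed.

(** * Characters and mean values *)

Section Characters.
Variable R : realType.
Implicit Types (z w : R[i]) (x y : R).

Lemma cexpD z w : cexp (z + w) = cexp z * cexp w.
Proof.
case: z w => a b [c d]; rewrite /cexp /= expRD real_complexM.
rewrite mulrACA; congr (_ * _); apply/eqP; rewrite eq_complex/=.
by rewrite cosD sinD eqxx [X in _ == X]addrC eqxx.
Qed.

Lemma normc_cexp z : normc (cexp z) = expR (complex.Re z).
Proof.
case: z => a b; rewrite /cexp normcM normc_real ger0_norm ?expR_ge0//=.
by rewrite cos2Dsin2 sqrtr1 mulr1.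
Qed.

Lemma cexp0 : cexp (0 : R[i]) = 1.
Proof. by rewrite /cexp /= expR0 cos0 sin0 mul1r. Qed.

Lemma cexp_real x : cexp x%:C = (expR x)%:C.
Proof. by rewrite /cexp /= cos0 sin0 mulr1. Qed.

Definition ee x : R[i] := cexp (0 +i* (pi * x)).

Lemma eeD x y : ee (x + y) = ee x * ee y.
Proof. by rewrite /ee -cexpD; congr cexp; apply/eqP; rewrite eq_complex/= addr0 mulrDr !eqxx. Qed.

Lemma ee0 : ee 0 = 1.
Proof. by rewrite /ee mulr0 cexp0. Qed.

Lemma normc_ee x : normc (ee x) = 1.
Proof. by rewrite /ee normc_cexp/= expR0. Qed.

Lemma ee_neq0 x : ee x != 0.
Proof. by apply/eqP => h; have := normc_ee x; rewrite h normc0 => /esym/eqP; rewrite oner_eq0. Qed.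

Lemma eeN x : ee (- x) = (ee x)^-1.
Proof. by apply: (mulfI (ee_neq0 x)); rewrite -eeD subrr ee0 mulfV// ee_neq0. Qed.

Lemma eeMn x n : ee (n%:R * x) = ee x ^+ n.
Proof.
elim: n => [|n IH]; first by rewrite mul0r ee0.
by rewrite -natr1 mulrDl mul1r eeD IH exprSr.
Qed.

Lemma conjcM z w : conjc (z * w) = conjc z * conjc w.
Proof. exact: rmorphM. Qed.

Lemma conjc_ee x : conjc (ee x) = ee (- x).
Proof.
rewrite eeN; apply: (mulfI (ee_neq0 x)); rewrite mulfV ?ee_neq0//.
by rewrite -normc_mul_conjc normc_ee expr1n.
Qed.

Lemma ee2 : ee 2 = 1.
Proof.
rewrite /ee /cexp /= expR0 mul1r.
have -> : pi * 2 = 0 + pi *+ 2 :> R by rewrite add0r mulr_natr.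
by rewrite cosD2pi sinD2pi cos0 sin0.
Qed.

Lemma ee_even (m : int) : ee (2 * m%:~R) = 1.
Proof.
have h (n : nat) : ee (2 * n%:R) = 1 by rewrite mulrC eeMn ee2 expr1n.
by case: m => n; rewrite ?NegzE ?mulrNz ?mulrN ?eeN h ?invr1.
Qed.

Lemma ee_neq1 x : 0 < x < 2 -> ee x != 1.
Proof.
move=> /andP[x0 x2]; apply/eqP; rewrite /ee /cexp /= expR0 mul1r => -[cosx _].
have : 0 < sin (pi * (x / 2)).
  apply: sin_gt0_pi; rewrite mulr_gt0 ?pi_gt0 ?divr_gt0//=.
  by rewrite gtr_pMr ?pi_gt0// ltr_pdivrMr// mul1r.
have e : pi * x = pi * (x / 2) *+ 2 by rewrite -mulr_natr; field.
move: cosx; rewrite e cos_mulr2n.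
have := cos2Dsin2 (pi * (x / 2)); move: (cos _) (sin _) => a b; nra.
Qed.

Lemma sum_ee (m : int) (N : nat) : (0 < `|m| < N)%N ->
  \sum_(j < N) ee (m%:~R * (2 * j%:R / N%:R)) = 0.
Proof.
move=> /andP[m0 mN]; have N0 : (0 < N)%N by apply: leq_ltn_trans mN.
have NR : N%:R != 0 :> R by rewrite pnatr_eq0 -lt0n.
pose z := ee (2 * m%:~R / N%:R).
have zN : z ^+ N = 1.
  by rewrite -eeMn mulrC divfK// ee_even.
have z1 : z != 1.
  rewrite /z; have: 0 < 2 * `|m|%:R / (N%:R : R) < 2.
    rewrite divr_gt0 ?mulr_gt0 ?ltr0n//= ltr_pdivrMr ?ltr0n//.
    by rewrite ltr_pM2l// ltr_nat.
  move=> /ee_neq1; rewrite natr_absz; have [m1|m1] := lerP 0 m.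
    by rewrite ger0_norm.
  by rewrite ltr0_norm// mulrNz mulrN mulNr eeN invr_eq1.
have : (z - 1) * (\sum_(j < N) ee (m%:~R * (2 * j%:R / N%:R))) = 0.
  rewrite (eq_bigr (fun j : 'I_N => z ^+ j)) => [|j _].
    by rewrite -subrX1 zN subrr.
  by rewrite -eeMn; congr ee; field.
by move/eqP; rewrite mulf_eq0 subr_eq0 (negbTE z1) => /eqP.
Qed.

Section Mean.
Variables (K : eqType) (r : seq K) (c : K -> R[i]) (w : K -> int).

Let P x := \sum_(k <- r) c k * ee ((w k)%:~R * x).

Lemma mean_coef (m : int) (N : nat) :
  (forall k, k \in r -> `|w k - m| < N)%N ->
  \sum_(j < N) P (2 * j%:R / N%:R) * ee (- (m%:~R * (2 * j%:R / N%:R))) =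
  N%:R * \sum_(k <- r | w k == m) c k.
Proof.
move=> wN; rewrite /P; under eq_bigr do rewrite mulr_suml.
rewrite exchange_big/= [in RHS]big_mkcond mulr_sumr big_seq [RHS]big_seq.
apply: eq_bigr => k kr; under eq_bigr do rewrite -mulrA -eeD -mulNr -mulrDl -intrB.
rewrite -mulr_sumr; case: eqVneq => [->|wm].
  under eq_bigr do rewrite subrr mul0r ee0.
  by rewrite sumr_const card_ord mulrC.
by rewrite sum_ee ?mulr0// wN// absz_gt0 subr_eq0 wm.
Qed.

Lemma dist_bound_exists (m : int) : exists N : nat, (0 < N)%N /\
  forall k, k \in r -> (`|w k - m| < N)%N.
Proof.
exists (\sum_(k <- r) `|w k - m|).+1; split => // k kr.
by rewrite ltnS (big_rem k)//= leq_addr.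
Qed.

Variable S : R.
Hypothesis PS : forall j N : nat, (0 < N)%N -> normc (P (2 * j%:R / N%:R)) <= S.

Lemma coef_bound (m : int) : normc (\sum_(k <- r | w k == m) c k) <= S.
Proof.
have [N [N0 /mean_coef e]] := dist_bound_exists m.
have NR : 0 < N%:R :> R by rewrite ltr0n.
rewrite -(ler_pM2l NR) -{1}(ger0_norm (ltW NR)) -normc_real -normcM.
rewrite real_complex_nat -e (le_trans (normc_sum _ _ _))//.
apply: (@le_trans _ _ (\sum_(j < N) S)).
  by apply: ler_sum => j _; rewrite normcM normc_ee mulr1 PS.
by rewrite sumr_const card_ord mulr_natl.
Qed.

Lemma bessel : uniq r -> {in r &, injective w} ->
  \sum_(k <- r) normc (c k) ^+ 2 <= S ^+ 2.
Proof.
move=> ur winj.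
have [N [N0 wN]] : exists N : nat, (0 < N)%N /\
    forall k l, k \in r -> l \in r -> (`|w k - w l| < N)%N.
  exists (\sum_(l <- r) \sum_(k <- r) `|w k - w l|).+1%N; split => // k l kr lr.
  by rewrite ltnS (big_rem l)//= (big_rem k)//= -addnA leq_addr.
have NR : 0 < N%:R :> R by rewrite ltr0n.
rewrite -(ler_pM2l NR).
have -> : N%:R * \sum_(k <- r) normc (c k) ^+ 2 =
    \sum_(j < N) normc (P (2 * j%:R / N%:R)) ^+ 2.
  apply: complexI; rewrite /= real_complexM !real_complex_sum real_complex_nat.
  under [RHS]eq_bigr => j _.
    rewrite normc_mul_conjc {2}/P rmorph_sum/= mulr_sumr.
    under eq_bigr do rewrite conjcM conjc_ee mulrCA.
    over.
  rewrite exchange_big/= mulr_sumr; apply: eq_big_seq => l lr.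
  rewrite -mulr_sumr (mean_coef (fun k kr => wN k l kr lr)).
  have -> : \sum_(k <- r | w k == w l) c k = c l.
    rewrite (big_rem l)//= eqxx big1_seq ?addr0// => k /andP[/eqP wkl].
    rewrite mem_rem_uniq// inE => /andP[kl kr].
    by move/winj: wkl kl => -> //; rewrite eqxx.
  by rewrite normc_mul_conjc; ring.
apply: (@le_trans _ _ (\sum_(j < N) S ^+ 2)).
  by apply: ler_sum => j _; rewrite lerXn2r ?nnegrE ?normc_ge0 ?PS// (le_trans _ (PS 0 N0))// normc_ge0.
by rewrite sumr_const card_ord mulr_natl.
Qed.

End Mean.
End Characters.

(** * Polynomials on the upper half plane *)

Lemma expr_le_linear_le1 (R : realType) (x : R) (d : nat) : 0 <= x ->
  (forall m : nat, x ^+ m <= (d * m).+1%:R) -> x <= 1.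
Proof.
move=> x0 h; rewrite leNgt; apply/negP => x1.
pose e := x - 1; have e0 : 0 < e by rewrite subr_gt0.
have bern (m : nat) : 1 + m%:R * e <= x ^+ m.
  elim: m => [|m IH]; first by rewrite mul0r addr0 expr0.
  rewrite exprS -natr1; have -> : x = 1 + e by rewrite /e; ring.
  have := ler0n R m; move: IH; rewrite (_ : x = 1 + e); last by rewrite /e; ring.
  by move: (m%:R) ((1 + e) ^+ m) => a b; nra.
have [m hm] : exists m : nat, (2 * d).+1%:R / e ^+ 2 < m%:R.
  by exists (Num.truncn ((2 * d).+1%:R / e ^+ 2)).+1; rewrite truncnS_gt.
have e2 : 0 < e ^+ 2 by rewrite exprn_gt0.
rewrite ltr_pdivrMr// in hm.
have m1 : 1 <= m%:R :> R.
  rewrite ler1n lt0n; apply/eqP => m0; move: hm; rewrite m0 mul0r.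
  by rewrite ltNge ler0n.
have := h (m * 2)%N; rewrite exprM mulnA mulnAC.
have : (1 + m%:R * e) ^+ 2 <= (x ^+ m) ^+ 2.
  by rewrite lerXn2r ?nnegrE ?exprn_ge0 ?bern// addr_ge0 ?mulr_ge0// ltW.
move: hm; rewrite -!natr1 !natrM.
move: m1 (ler0n R d) e0; move: (m%:R : R) ((x ^+ m) ^+ 2) (d%:R : R) (e) => a b c y.
move=> a1 c0 y0 /ltW h1 h2 h3.
have h4 : a * (2 * c + 1) <= a * (a * y ^+ 2) by rewrite ler_wpM2l//; lra.
have h5 : 0 <= a * y by rewrite mulr_ge0//; lra.
by move: h2 h3 h4 h5; rewrite !expr2; lra.
Qed.

Section MaxPrinciple.
Variable R : realType.

Lemma poly_coef_sum_bound (p : {poly R[i]}) (S rho : R) :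
  (forall j N : nat, (0 < N)%N -> normc p.[ee (2 * j%:R / N%:R)] <= S) ->
  0 <= rho <= 1 -> normc p.[rho%:C] <= (size p)%:R * S.
Proof.
move=> pS /andP[r0 r1].
have coefp (k : nat) : (k < size p)%N -> normc p`_k <= S.
  move=> kp.
  have := @coef_bound R nat (iota 0 (size p)) (fun j => p`_j) Posz S.
  move=> /(_ _ k%:Z); rewrite (eq_bigl (fun j => j == k)) => [|j]; last exact: eqz_nat.
  rewrite -big_filter filter_pred1_uniq ?iota_uniq ?mem_iota ?add0n// big_seq1.
  apply => j N N0.
  rewrite (le_trans _ (pS j N N0))// horner_coef -(big_mkord xpredT (fun k => p`_k * _ ^+ k)).
  rewrite /index_iota subn0 le_eqVlt; apply/orP; left; apply/eqP/congr1/eq_bigr => l _.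
  by rewrite -eeMn.
rewrite horner_coef (le_trans (normc_sum _ _ _))//.
apply: (@le_trans _ _ (\sum_(i < size p) S)); last first.
  by rewrite sumr_const card_ord mulr_natl.
apply: ler_sum => k _; rewrite normcM normcX normc_real ger0_norm//.
rewrite (le_trans _ (coefp _ (ltn_ord k)))// ler_piMr ?normc_ge0//.
exact: exprn_ile1.
Qed.

Lemma poly_max (p : {poly R[i]}) (S rho : R) :
  (forall j N : nat, (0 < N)%N -> normc p.[ee (2 * j%:R / N%:R)] <= S) ->
  0 <= rho <= 1 -> normc p.[rho%:C] <= S.
Proof.
move=> pS r01.
have S0 : 0 <= S by rewrite (le_trans (normc_ge0 _) (pS 0%N 1%N isT)).
have pw (m : nat) : normc p.[rho%:C] ^+ m <= ((size p).-1 * m).+1%:R * S ^+ m.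
  rewrite -normcX -horner_exp.
  have := @poly_coef_sum_bound (p ^+ m) (S ^+ m) rho.
  move=> /(_ _ r01) h; apply: le_trans (h _) _ => [j N N0|].
    by rewrite horner_exp normcX lerXn2r ?nnegrE ?normc_ge0// pS.
  by rewrite ler_wpM2r ?exprn_ge0// ler_nat size_poly_exp_leq.
have [S00|S1] := eqVneq S 0.
  by have := pw 1%N; rewrite !expr1 S00 mulr0.
have Sp : 0 < S by rewrite lt_def S1.
rewrite -[leRHS]mul1r -ler_pdivrMr//.
apply: (@expr_le_linear_le1 _ _ (size p).-1); first by rewrite divr_ge0 ?normc_ge0.
by move=> m; rewrite expr_div_n ler_pdivrMr ?exprn_gt0.
Qed.

End MaxPrinciple.

Lemma int_poly_nonroot (P : {poly int}) : P != 0 ->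
  exists B : nat, P.[B%:Z] != 0.
Proof.
move=> P0; apply: contrapT => h.
have r (B : nat) : root P B%:Z.
  by apply/negPn/negP => rB; apply: h; exists B.
have := @max_poly_roots _ P [seq (Posz k) | k <- iota 0 (size P)] P0.
rewrite size_map size_iota ltnn => /(_ _ _)/negP; apply => //.
  by apply/allP => _ /mapP[k _ ->].
by rewrite map_inj_uniq ?iota_uniq// => x y [].
Qed.

Lemma separating_base (I : finType) (r : seq {ffun I -> int}) :
  exists B : nat, {in r &, injective (fun p : {ffun I -> int} =>
    \sum_i p i * B%:Z ^+ enum_rank i)}.
Proof.
pose Pol (p : {ffun I -> int}) : {poly int} :=
  \sum_i (p i) *: 'X^(enum_rank i).
have PolE p B : (Pol p).[B] = \sum_i p i * B ^+ enum_rank i.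
  rewrite /Pol horner_sum; apply: eq_bigr => i _.
  by rewrite hornerZ hornerXn.
have Polinj : injective Pol.
  move=> p q pq; apply/ffunP => i.
  have cf (u : {ffun I -> int}) : (Pol u)`_(enum_rank i) = u i.
    rewrite /Pol coef_sum (bigD1 i)//= coefZ coefXn eqxx mulr1.
    rewrite big1 ?addr0// => j ji; rewrite coefZ coefXn.
    by rewrite eq_sym (inj_eq val_inj) (inj_eq enum_rank_inj) (negbTE ji) mulr0.
  by rewrite -cf pq cf.
pose Q := \prod_(p <- r) \prod_(q <- r | q != p) (Pol p - Pol q).
have Q0 : Q != 0.
  rewrite prodf_seq_neq0; apply/allP => p _ /=.
  rewrite prodf_seq_neq0; apply/allP => q _ /=; apply/implyP => qp.
  by rewrite subr_eq0 (inj_eq Polinj) eq_sym.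
have [B hB] := int_poly_nonroot Q0; exists B => p q pr qr; rewrite -!PolE => e.
apply/eqP/negPn/negP => pq; move: hB.
rewrite horner_prod prodf_seq_neq0 => /allP /(_ _ pr)/=.
rewrite horner_prod prodf_seq_neq0 => /allP /(_ _ qr)/=.
by rewrite eq_sym pq/= hornerD hornerN e subrr eqxx.
Qed.

Section Fibers.
Variables (R : realType) (I : finType) (K : choiceType).
Variables (c : K -> R[i]) (p : K -> {ffun I -> int}) (B S : R).

Definition rational_point (x : I -> R) :=
  exists2 N : nat, (0 < N)%N & forall i, N%:R * x i \is a Num.int.

Hypothesis cB : abs_bounded c B.
Hypothesis cS : forall x, rational_point x ->
  exists2 s, has_sum (fun k => c k * ee (\sum_i (p k i)%:~R * x i)) s & normc s <= S.

Lemma one_parameter_truncation e : 0 < e -> exists F0 : {fset K}, forall F,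
  (F0 `<=` F)%fset -> exists w : K -> int,
  [/\ forall k l, p k = p l -> w k = w l,
     forall k l, k \in F -> l \in F -> w k = w l -> p k = p l &
     forall j N : nat, (0 < N)%N ->
      normc (\sum_(k <- F) c k * ee ((w k)%:~R * (2 * j%:R / N%:R))) <= S + e].
Proof.
move=> e0; have [F0 hF0] := abs_bounded_tail cB e0.
exists F0 => F F0F; have [b hb] := separating_base [seq p k | k <- F].
pose om (q : {ffun I -> int}) := \sum_i q i * b%:Z ^+ enum_rank i.
exists (om \o p); split => [k l /= -> //|k l kF lF|j N N0].
  by apply: hb; apply: map_f.
have NR : N%:R != 0 :> R by rewrite pnatr_eq0 -lt0n.
pose x (i : I) : R := (b%:Z ^+ enum_rank i)%:~R * (2 * j%:R / N%:R).
have xr : rational_point x.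
  exists N => // i; have -> : N%:R * x i =
      (b%:Z ^+ enum_rank i * (2 * j%:Z))%:~R :> R.
    by rewrite /x !intrM; field.
  exact: intr_int.
have ch k : ee (\sum_i (p k i)%:~R * x i) = ee ((om (p k))%:~R * (2 * j%:R / N%:R)).
  congr ee; rewrite /om rmorph_sum/= mulr_suml; apply: eq_bigr => i _.
  by rewrite intrM mulrA.
have [s hs sS] := cS xr.
under eq_bigr do rewrite -ch.
set d := fun k => c k * ee (\sum_i (p k i)%:~R * x i) in hs.
have dE k : normc (d k) = normc (c k) by rewrite normcM normc_ee mulr1.
have dB : abs_bounded d B by apply: abs_boundedW cB => k; rewrite dE.
have := has_sum_tail dB hs e0; move=> /(_ F0) h.
have {}h : normc (s - \sum_(k <- F) d k) <= e.
  by apply: h => // G; under eq_bigr do rewrite dE.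
rewrite -(subrK s (\sum_(k <- F) _)) addrC (le_trans (le_normcD _ _))// lerD//.
by rewrite normcB.
Qed.

Lemma fiber_bound p0 s :
  has_sum (fun k => if p k == p0 then c k else 0) s -> normc s <= S.
Proof.
move=> hs; apply/ler_addgt0Pl => e e0.
have e20 : 0 < e / 2 by rewrite divr_gt0.
have [F0 h0] := one_parameter_truncation e20.
have [F1 h1] := hs _ e20.
have [w [w1 w2 wS]] := h0 _ (fsubsetUl F0 F1).
have := h1 _ (fsubsetUr F0 F1).
set F := (F0 `|` F1)%fset in w2 wS *; rewrite -big_mkcond/= => hF.
have {}hF' : normc (\sum_(k <- F | p k == p0) c k) <= S + e / 2.
  have [/hasP[k kF /eqP pk]|nF] := boolP (has (fun k => p k == p0) F).
    suff -> : \sum_(l <- F | p l == p0) c l = \sum_(l <- F | w l == w k) c l.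
      exact: (coef_bound wS (w k)).
    rewrite big_seq_cond [RHS]big_seq_cond; apply: eq_bigl => l.
    case: (boolP (l \in F)) => //= lF; rewrite -pk.
    by apply/eqP/eqP => [/w1|/w2 ->].
  rewrite big1_seq ?normc0.
    have := wS 0%N 1%N isT; move: (normc_ge0 (\sum_(k <- F) c k * ee ((w k)%:~R * (2 * 0%:R / 1%:R)))); lra.
  by move=> k /andP[pk kF]; move: (hasPn nF _ kF); rewrite pk.
rewrite -[s](subrK (\sum_(k <- F | p k == p0) c k)) (le_trans (le_normcD _ _))//.
rewrite normcB; move: hF hF'; set x := normc _; set y := normc _; lra.
Qed.

Lemma fiber_bessel (F : {fset K}) :
  (forall k l, c k != 0 -> c l != 0 -> p k = p l -> k = l) ->
  \sum_(k <- F) normc (c k) ^+ 2 <= S ^+ 2.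
Proof.
move=> pinj.
have S0 : 0 <= S.
  have [|s _] := cS (x := fun=> 0); last exact: le_trans (normc_ge0 _).
  by exists 1%N => // i; rewrite mulr0 int_num0.
suff h e : 0 < e -> e <= 1 -> \sum_(k <- F) normc (c k) ^+ 2 <= (S + e) ^+ 2.
  apply/ler_addgt0Pl => e e0.
  pose d := Num.min 1 (e / (2 * S + 1)).
  have S1 : 0 < 2 * S + 1 by lra.
  have d0 : 0 < d by rewrite lt_min ltr01 divr_gt0.
  have d1 : d <= 1 by rewrite ge_min lexx.
  have : d * (2 * S + 1) <= e by rewrite -ler_pdivlMr// ge_min lexx orbT.
  have := h d d0 d1; move: d d0 d1 {h} => d; nra.
move=> e0 e1; have [F0 h0] := one_parameter_truncation e0.
have [w [w1 w2 wS]] := h0 _ (fsubsetUl F0 F).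
set G := (F0 `|` F)%fset in w2 wS.
pose r := [seq k <- G | c k != 0].
have := @bessel R K r c w (S + e).
have rsum (V : nmodType) (f : K -> V) (H : {fset K}) : (forall k, c k = 0 -> f k = 0) ->
    \sum_(k <- H) f k = \sum_(k <- [seq k <- H | c k != 0]) f k.
  move=> f0; rewrite big_filter [RHS]big_mkcond/=; apply: eq_bigr => k _.
  by case: eqVneq => // /f0.
move=> /(_ _ _ _) h; apply: le_trans (h _ _ _) => [|j N N0||k l].
- rewrite -rsum => [|k ->]; last by rewrite normc0 expr0n.
  by apply: sum_nneg_sub => [|k]; rewrite ?fsubsetUr// exprn_ge0// normc_ge0.
- by rewrite -rsum ?wS// => k ->; rewrite mul0r.
- by rewrite filter_uniq.
- rewrite !mem_filter => /andP[ck kG] /andP[cl lG] /w2 => /(_ kG lG).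
  exact: pinj.
Qed.

End Fibers.

(** * The symplectic group *)

Section Symplectic.
Variables (R : realType) (g : nat).
Implicit Types (M N : 'M[int]_(g + g)) (tau : 'M[R[i]]_g).

Local Notation iC := (mx_int_to_C R).

Lemma mx_int_to_CM m n p (A : 'M[int]_(m, n)) (B : 'M[int]_(n, p)) :
  iC (A *m B) = iC A *m iC B.
Proof. exact: map_mxM. Qed.

Lemma mx_int_to_C_tr m n (A : 'M[int]_(m, n)) : iC A^T = (iC A)^T.
Proof. by rewrite /mx_int_to_C map_trmx. Qed.

Lemma mx_int_to_C1 n : iC (1%:M : 'M[int]_n) = 1%:M.
Proof. exact: map_mx1. Qed.

Lemma mx_int_to_C0 m n : iC (0 : 'M[int]_(m, n)) = 0.
Proof. exact: map_mx0. Qed.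

Definition act_num M tau := iC (ulsubmx M) *m tau + iC (ursubmx M).

Lemma siegel_actE M tau :
  siegel_act M tau = act_num M tau *m invmx (automorphy_mx M tau).
Proof. by []. Qed.

Lemma siegel_act_unique M tau s : automorphy_mx M tau \in unitmx ->
  act_num M tau = s *m automorphy_mx M tau -> siegel_act M tau = s.
Proof. by move=> Qu; rewrite siegel_actE => ->; rewrite mulmxK. Qed.

Lemma mul_frame M tau :
  iC M *m col_mx tau 1%:M = col_mx (act_num M tau) (automorphy_mx M tau).
Proof.
rewrite -{1}(submxK M) /mx_int_to_C map_block_mx mul_block_col !mulmx1.
by [].
Qed.

Definition conjmx m n (A : 'M[R[i]]_(m, n)) : 'M[R[i]]_(m, n) := map_mx (@conjc R) A.

Lemma conjmxM m n p (A : 'M[R[i]]_(m, n)) (B : 'M[R[i]]_(n, p)) :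
  conjmx (A *m B) = conjmx A *m conjmx B.
Proof. exact: map_mxM. Qed.

Lemma conjmx_tr m n (A : 'M[R[i]]_(m, n)) : conjmx A^T = (conjmx A)^T.
Proof. by rewrite /conjmx map_trmx. Qed.

Lemma conjmx_int m n (A : 'M[int]_(m, n)) : conjmx (iC A) = iC A.
Proof. by apply/matrixP => i j; rewrite !mxE rmorph_int. Qed.

Lemma conj_frame M tau : conjmx (automorphy_mx M tau) = automorphy_mx M (conjmx tau).
Proof. by rewrite /conjmx map_mxD map_mxM/= -!/(conjmx _) !conjmx_int. Qed.

Lemma conj_num M tau : conjmx (act_num M tau) = act_num M (conjmx tau).
Proof. by rewrite /conjmx map_mxD map_mxM/= -!/(conjmx _) !conjmx_int. Qed.

Lemma form_frame tau tau' :
  (col_mx tau 1%:M)^T *m iC (symplectic_form g) *m col_mx tau' 1%:M = tau^T - tau'.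
Proof.
rewrite tr_col_mx trmx1 /symplectic_form /mx_int_to_C map_block_mx map_mx0 map_mxN map_mx1.
rewrite mul_row_block !mulmx0 mul1mx add0r mulmx1 addr0 mul_row_col mulmx1.
by rewrite mulNmx mul1mx addrC.
Qed.

Lemma symplectic_pairing M tau tau' : Sp_int M ->
  (act_num M tau)^T *m automorphy_mx M tau' - (automorphy_mx M tau)^T *m act_num M tau'
  = tau^T - tau'.
Proof.
move=> SpM; rewrite -form_frame.
have -> : iC (symplectic_form g) = (iC M)^T *m iC (symplectic_form g) *m iC M.
  by rewrite -mx_int_to_C_tr -!mx_int_to_CM SpM.
rewrite !mulmxA -mulmxA -trmx_mul mul_frame -!mulmxA mul_frame.
rewrite tr_col_mx /symplectic_form /mx_int_to_C map_block_mx map_mx0 map_mxN map_mx1.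
rewrite mul_block_col !mul0mx mul1mx add0r addr0 mulNmx mul1mx.
by rewrite mul_row_col mulmxN.
Qed.

Lemma imag_tau tau : tau - conjmx tau = (2 * 'i%C) *: map_mx (real_complex R) (map_mx (@complex.Im R) tau).
Proof.
apply/matrixP => i j; rewrite !mxE; case: (tau i j) => a b /=.
by apply/eqP; rewrite eq_complex /=; apply/andP; split; apply/eqP; ring.
Qed.

Lemma hermitian_posdef (Y : 'M[R]_g) (u : 'rV[R[i]]_g) : posdef Y -> u != 0 ->
  exists2 r : R, 0 < r & (u *m map_mx (real_complex R) Y *m (conjmx u)^T) 0 0 = r%:C.
Proof.
move=> [Ysym Ypos] u0.
pose a := map_mx (@complex.Re R) u; pose b := map_mx (@complex.Im R) u.
pose rC m n (A : 'M[R]_(m, n)) := map_mx (real_complex R) A.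
have uE : u = rC _ _ a + 'i%C *: rC _ _ b.
  by apply/matrixP => i j; rewrite !mxE -complexE.
have cE : conjmx u = rC _ _ a - 'i%C *: rC _ _ b.
  apply/matrixP => i j; rewrite !mxE; case: (u i j) => x y /=.
  by apply/eqP; rewrite eq_complex /=; apply/andP; split; apply/eqP; ring.
pose q (x y : 'rV[R]_g) := (x *m Y *m y^T) 0 0.
have qC x y : (rC _ _ x *m map_mx (real_complex R) Y *m (rC _ _ y)^T) 0 0 = (q x y)%:C.
  by rewrite /rC map_trmx -!map_mxM mxE.
have qs x y : q x y = q y x.
  rewrite /q; have -> : y *m Y *m x^T = (x *m Y *m y^T)^T.
    by rewrite !trmx_mul trmxK Ysym mulmxA.
  by rewrite [RHS]mxE.
exists (q a a + q b b).
  have qge x : 0 <= q x x.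
    have [->|/Ypos/ltW//] := eqVneq x 0; by rewrite /q !mul0mx mxE.
  have [a0|/Ypos] := eqVneq a 0; last by move=> h; apply: ltr_wpDr.
  have [b0|/Ypos] := eqVneq b 0; last by move=> h; apply: ltr_wpDl.
  by case/eqP: u0; rewrite uE a0 b0 /rC !map_mx0 scaler0 addr0.
rewrite uE -uE cE uE raddfB/= linearZ/= mulmxBr !mulmxDl -!scalemxAl -!scalemxAr.
rewrite !mxE -!/(_ 0 0) .
move: (qC a a) (qC b b) (qC a b) (qC b a); rewrite !mxE => -> -> -> ->.
rewrite (qs b a); set x := q a a; set y := q b b; set z := q a b.
by apply/eqP; rewrite eq_complex /=; apply/andP; split; apply/eqP; ring.
Qed.

Lemma automorphy_unit M tau : Sp_int M -> siegel_space tau ->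
  automorphy_mx M tau \in unitmx.
Proof.
move=> SpM [tsym tpos]; rewrite -unitmx_tr -row_free_unit; apply: inj_row_free => v vQ.
apply/eqP/negPn/negP => v0.
have [r r0 rE] := hermitian_posdef tpos v0.
have := symplectic_pairing tau (conjmx tau) SpM.
rewrite tsym imag_tau -conj_frame -conj_num => e.
have : (v *m ((2 * 'i%C) *: map_mx (real_complex R) (map_mx (@complex.Im R) tau)) *m (conjmx v)^T) 0 0 = 0.
  rewrite -e mulmxBr mulmxBl !mulmxA vQ !mul0mx subr0 -mulmxA.
  suff -> : conjmx (automorphy_mx M tau) *m (conjmx v)^T = 0 by rewrite mulmx0 mxE.
  have /(congr1 (@conjmx _ _)) : automorphy_mx M tau *m v^T = 0.
    by rewrite -[LHS]trmxK trmx_mul trmxK vQ trmx0.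
  by rewrite conjmxM /conjmx map_trmx map_mx0.
rewrite -scalemxAr -scalemxAl mxE rE => /eqP.
rewrite !mulf_eq0 pnatr_eq0/= => /orP[|].
  by rewrite eq_complex/= oner_eq0 andbF.
by rewrite eq_complex/= eqxx andbT gt_eqF.
Qed.

Lemma siegel_act_space M tau : Sp_int M -> siegel_space tau ->
  siegel_space (siegel_act M tau).
Proof.
move=> SpM Ht; have Qu := automorphy_unit SpM Ht; have [tsym tpos] := Ht.
rewrite siegel_actE; set Q := automorphy_mx M tau in Qu *; set P := act_num M tau.
set s := P *m invmx Q.
have sQ : s *m Q = P by rewrite /s mulmxKV.
have ssym : s^T = s.
  have := symplectic_pairing tau tau SpM; rewrite -/P -/Q tsym subrr => /eqP.
  rewrite subr_eq0 -sQ trmx_mul -!mulmxA => /eqP.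
  have Qtu : Q^T \in unitmx by rewrite unitmx_tr.
  by move=> /(can_inj (mulKmx Qtu)); rewrite mulmxA => /(can_inj (mulmxK Qu)).
split => //; split; first by rewrite map_trmx ssym.
move=> v v0; pose vC := map_mx (real_complex R) v.
have vC0 : vC != 0 by rewrite map_mx_eq0.
pose u := vC *m invmx Q^T.
have Qtu : Q^T \in unitmx by rewrite unitmx_tr.
have uQ : u *m Q^T = vC by rewrite /u mulmxKV.
have u0 : u != 0 by apply: contraNneq vC0 => u0; rewrite -uQ u0 mul0mx.
have [r r0 rE] := hermitian_posdef tpos u0.
have e : Q^T *m (s - conjmx s) *m conjmx Q =
    (2 * 'i%C) *: map_mx (real_complex R) (map_mx (@complex.Im R) tau).
  rewrite -imag_tau; have := symplectic_pairing tau (conjmx tau) SpM.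
  rewrite tsym -conj_frame -conj_num -/P -/Q => <-.
  rewrite mulmxBr mulmxBl; congr (_ - _); last by rewrite -mulmxA -conjmxM sQ.
  have -> : P^T = Q^T *m s by rewrite -sQ trmx_mul ssym.
  by [].
have vreal : conjmx vC = vC.
  by apply/matrixP => i j; rewrite !mxE conjc_real.
have : (u *m (Q^T *m (s - conjmx s) *m conjmx Q) *m (conjmx u)^T) 0 0 = 2 * 'i%C * r%:C.
  by rewrite e -scalemxAr -scalemxAl mxE rE.
rewrite !mulmxA uQ -mulmxA.
have -> : conjmx Q *m (conjmx u)^T = vC^T.
  by rewrite -vreal -uQ conjmxM conjmx_tr trmx_mul trmxK.
rewrite imag_tau -scalemxAr -scalemxAl mxE => /mulfI h.
suff : ((v *m map_mx (@complex.Im R) s *m v^T) 0 0)%:C = r%:C :> R[i].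
  by case=> ->.
rewrite -h; last by rewrite mulf_neq0 ?pnatr_eq0// eq_complex/= oner_eq0 andbF.
by rewrite /vC map_trmx -!map_mxM [RHS]mxE.
Qed.

Lemma Sp_int_mul M N : Sp_int M -> Sp_int N -> Sp_int (M *m N).
Proof.
move=> SpM SpN; rewrite /Sp_int/= trmx_mul -!mulmxA [M^T *m _]mulmxA.
by rewrite [_ *m (M *m N)]mulmxA SpM [N^T *m _]mulmxA SpN.
Qed.

Lemma act_num_mul M N tau : Sp_int N -> siegel_space tau ->
  act_num (M *m N) tau = act_num M (siegel_act N tau) *m automorphy_mx N tau /\
  automorphy_mx (M *m N) tau =
    automorphy_mx M (siegel_act N tau) *m automorphy_mx N tau.
Proof.
move=> SpN Ht; have Qu := automorphy_unit SpN Ht.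
apply/eq_col_mx; rewrite -mul_frame mx_int_to_CM -mulmxA (mul_frame N) -mul_col_mx -(mul_frame M).
by rewrite -mulmxA mul_col_mx mul1mx siegel_actE mulmxKV.
Qed.

Lemma slash_mul k M N f tau : Sp_int M -> Sp_int N -> siegel_space tau ->
  slash k (M *m N) f tau = \det (automorphy_mx N tau) ^- k * slash k M f (siegel_act N tau).
Proof.
move=> SpM SpN Ht; have [e1 e2] := act_num_mul M SpN Ht.
have Qu := automorphy_unit SpN Ht.
have Mu := automorphy_unit SpM (siegel_act_space SpN Ht).
rewrite /slash; have -> : siegel_act (M *m N) tau = siegel_act M (siegel_act N tau).
  apply: siegel_act_unique; first by rewrite e2 unitmx_mul Mu Qu.
  by rewrite e1 e2 mulmxA [siegel_act M _]siegel_actE mulmxKV.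
by rewrite e2 det_mulmx exprMn invfM mulrA [_^-1 * _^-1]mulrC.
Qed.

Lemma Sp_int_inv M : Sp_int M ->
  exists2 N, Sp_int N & N *m M = 1%:M /\ M *m N = 1%:M.
Proof.
move=> SpM; pose J := symplectic_form g; pose N := - J *m M^T *m J.
have JJ : J *m J = - 1%:M.
  rewrite /J /symplectic_form mulmx_block !mul0mx !mulmx0 !mul1mx !mulmx1 !addr0 add0r.
  by rewrite [X in _ = - X]scalar_mx_block opp_block_mx !oppr0.
have NM : N *m M = 1%:M.
  by rewrite /N -mulmxA -mulmxA [M^T *m _]mulmxA [M^T *m J *m M]SpM mulNmx JJ opprK.
have MN := mulmx1C NM; clearbody N; exists N => //.
rewrite /Sp_int/= -/J; have -> : N^T *m J = N^T *m (M^T *m J *m M) by rewrite SpM.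
have NMt : N^T *m M^T = 1%:M by rewrite -trmx_mul MN trmx1.
by rewrite !mulmxA NMt mul1mx -mulmxA MN mulmx1.
Qed.

Local Notation red2 := (map_mx (fun z : int => z%:~R : 'F_2)).

Lemma slash_congr k f M N tau : modular_form_Gamma2 k f ->
  Sp_int M -> Sp_int N -> red2 M = red2 N -> siegel_space tau ->
  slash k M f tau = slash k N f tau.
Proof.
move=> [_ fmod _] SpM SpN MN Ht.
have [N' SpN' [N'N NN']] := Sp_int_inv SpN.
have G : Gamma2 (M *m N').
  split; first exact: Sp_int_mul.
  by rewrite map_mxM/= MN -map_mxM/= NN' map_mx1.
have SpG := Sp_int_mul SpM SpN'.
have -> : M = (M *m N') *m N by rewrite -mulmxA N'N mulmx1.
have HN := siegel_act_space SpN Ht.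
rewrite slash_mul// /slash fmod//; congr (_ * _).
rewrite mulKf// expf_neq0//; have := automorphy_unit SpG HN.
by rewrite unitmxE unitfE.
Qed.

End Symplectic.

Section Elements.
Variables (R : realType) (g : nat).
Local Notation iC := (mx_int_to_C R).

Definition translation_mx (X : 'M[int]_g) : 'M[int]_(g + g) := block_mx 1%:M X 0 1%:M.

Definition levi_mx (U V : 'M[int]_g) : 'M[int]_(g + g) := block_mx U 0 0 V.

Lemma translation_Sp X : X^T = X -> Sp_int (translation_mx X).
Proof.
move=> Xs; rewrite /Sp_int/= /translation_mx /symplectic_form tr_block_mx !trmx1 trmx0 Xs.
rewrite !mulmx_block !mul0mx !mulmx0 !mul1mx !mulmx1 !addr0 !add0r.
by rewrite mulNmx mul1mx mul0mx add0r addNr.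
Qed.

Lemma levi_Sp U V : U^T *m V = 1%:M -> Sp_int (levi_mx U V).
Proof.
move=> UV; have VU : V^T *m U = 1%:M by rewrite -[LHS]trmxK trmx_mul trmxK UV trmx1.
rewrite /Sp_int/= /levi_mx /symplectic_form tr_block_mx !trmx0.
rewrite !mulmx_block !mul0mx !mulmx0 !mulmx1 !addr0 !add0r.
by rewrite UV mulmxN mulNmx mulmx1 !mul0mx VU.
Qed.

Implicit Types (f : 'M[R[i]]_g -> R[i]) (tau : 'M[R[i]]_g) (M : 'M[int]_(g + g)).

Lemma slash_translation k M X f tau : Sp_int M -> X^T = X -> siegel_space tau ->
  slash k (M *m translation_mx X) f tau = slash k M f (tau + iC X).
Proof.
move=> SpM Xs Ht; have SpX := translation_Sp Xs.
have jX : automorphy_mx (translation_mx X) tau = 1%:M.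
  by rewrite /automorphy_mx block_mxKdl block_mxKdr mx_int_to_C0 mx_int_to_C1 mul0mx add0r.
rewrite slash_mul// (@siegel_act_unique _ _ _ _ (tau + iC X)) ?jX ?unitmx1//.
  by rewrite det1 expr1n invr1 mul1r.
by rewrite /act_num block_mxKul block_mxKur mx_int_to_C1 mul1mx mulmx1.
Qed.

Lemma int_det_sqr (U V : 'M[int]_g) : U^T *m V = 1%:M -> \det V ^+ 2 = 1.
Proof.
move=> /(congr1 determinant); rewrite det_mulmx det1 det_tr => e.
have : (`|\det U| * `|\det V| = 1)%N by rewrite -abszM e.
move=> /eqP; rewrite muln_eq1 => /andP[_ /eqP dV].
by rewrite -real_normK ?num_real// -abszE dV.
Qed.

Lemma levi_space U V tau : U^T *m V = 1%:M -> siegel_space tau ->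
  @siegel_space R g (iC U *m tau *m (iC U)^T).
Proof.
move=> UV Ht; have SpL := levi_Sp UV.
have jV : automorphy_mx (levi_mx U V) tau = iC V.
  by rewrite /automorphy_mx block_mxKdl block_mxKdr mx_int_to_C0 mul0mx add0r.
have := automorphy_unit SpL Ht; rewrite jV => uV.
rewrite -(@siegel_act_unique _ _ (levi_mx U V) tau (iC U *m tau *m (iC U)^T)) ?jV//.
  exact: siegel_act_space.
rewrite /act_num block_mxKul block_mxKur mx_int_to_C0 addr0.
by rewrite -mulmxA -mx_int_to_C_tr -mx_int_to_CM UV mx_int_to_C1 mulmx1.
Qed.

Lemma slash_levi M U V f tau : Sp_int M -> U^T *m V = 1%:M -> siegel_space tau ->
  slash 2 (M *m levi_mx U V) f tau = slash 2 M f (iC U *m tau *m (iC U)^T).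
Proof.
move=> SpM UV Ht; have SpL := levi_Sp UV.
have jV : automorphy_mx (levi_mx U V) tau = iC V.
  by rewrite /automorphy_mx block_mxKdl block_mxKdr mx_int_to_C0 mul0mx add0r.
have dV : \det (iC V) ^+ 2 = 1.
  by rewrite /mx_int_to_C det_map_mx -rmorphXn/= (int_det_sqr UV).
have := automorphy_unit SpL Ht; rewrite jV => uV.
rewrite slash_mul// (@siegel_act_unique _ _ _ _ (iC U *m tau *m (iC U)^T)) ?jV//.
  by rewrite dV invr1 mul1r.
rewrite /act_num block_mxKul block_mxKur mx_int_to_C0 addr0.
by rewrite -mulmxA -mx_int_to_C_tr -mx_int_to_CM UV mx_int_to_C1 mulmx1.
Qed.

End Elements.

Section Inversion.
Variables (R : realType) (n : nat).
Local Notation iC := (mx_int_to_C R).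
Local Notation rC := (map_mx (real_complex R)).

Definition first_inversion : 'M[int]_((1 + n) + (1 + n)) :=
  block_mx (block_mx 0 0 0 1%:M) (block_mx (- 1%:M) 0 0 0)
           (block_mx 1%:M 0 0 0) (block_mx 0 0 0 1%:M).

Lemma first_inversion_Sp : Sp_int first_inversion.
Proof.
rewrite /Sp_int/= /first_inversion /symplectic_form.
rewrite !tr_block_mx !trmx0 !trmx1 raddfN/= trmx1.
do ! rewrite (mulmx_block, mul0mx, mulmx0, mul1mx, mulmx1, addr0, add0r, mulmxN,
  mulNmx, oppr0, opp_block_mx, add_block_mx, opprK).
by rewrite [1%:M in RHS]scalar_mx_block opp_block_mx !oppr0 !block_mx_const.
Qed.

Lemma slash_first_inversion k (M : 'M[int]_((1 + n) + (1 + n))) f (t : R[i]) z tau' :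
  Sp_int M -> siegel_space (block_mx t%:M z z^T tau') -> t != 0 ->
  slash k (M *m first_inversion) f (block_mx t%:M z z^T tau') =
  t ^- k * slash k M f (block_mx (- t^-1)%:M (t^-1 *: z) (t^-1 *: z^T)
                         (tau' - t^-1 *: (z^T *m z))).
Proof.
move=> SpM Ht t0; set tau := block_mx _ _ _ _.
have j : automorphy_mx first_inversion tau = block_mx t%:M z 0 1%:M.
  rewrite /automorphy_mx block_mxKdl block_mxKdr /mx_int_to_C !map_block_mx !map_mx0 !map_mx1.
  by rewrite mulmx_block !mul0mx !mul1mx add_block_mx !addr0 !add0r.
rewrite slash_mul//; last exact: first_inversion_Sp.
have dj : \det (automorphy_mx first_inversion tau) = t.
  by rewrite j det_ublock det_scalar1 det1 mulr1.
rewrite dj; congr (_ * slash k M f _).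
apply: siegel_act_unique; first by rewrite unitmxE dj unitfE.
rewrite j /act_num block_mxKul block_mxKur /mx_int_to_C !map_block_mx !map_mx0 map_mxN !map_mx1.
rewrite !mulmx_block !mul0mx !mul1mx !mulmx0 !mulmx1 add_block_mx !addr0 !add0r.
have e (A : 'M[R[i]]_(n, 1)) : t^-1 *: A *m t%:M = A.
  by rewrite mul_mx_scalar scalerA mulfV// scale1r.
congr block_mx.
- by rewrite -scalar_mxM mulNr mulVf// raddfN.
- by rewrite mul_scalar_mx scaleNr addNr.
- by rewrite e.
- by rewrite -scalemxAl addrC subrK.
Qed.

End Inversion.

(** * The Jacobi slice of the half space *)

Lemma tr_oppmx (V : zmodType) m n (A : 'M[V]_(m, n)) : (- A)^T = - A^T.
Proof. exact: raddfN. Qed.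

Lemma tr_addmx (V : zmodType) m n (A B : 'M[V]_(m, n)) : (A + B)^T = A^T + B^T.
Proof. exact: raddfD. Qed.

Lemma tr_scalemx (V : comNzRingType) m n (a : V) (A : 'M[V]_(m, n)) :
  (a *: A)^T = a *: A^T.
Proof. exact: linearZ. Qed.

Section Slices.
Variables (R : realType) (n : nat).
Local Notation iC := (mx_int_to_C R).
Local Notation rC := (map_mx (real_complex R)).
Local Notation iR := (map_mx (fun z : int => z%:~R : R)).
Implicit Types (l m : 'rV[R]_n) (t : R[i]) (X : 'M[R]_n) (T : 'M[R]_(1 + n)).

Definition affine_row l : 'rV[R]_(1 + n) := row_mx 1%:M l.

Definition slice l m t X : 'M[R[i]]_(1 + n) :=
  t *: rC ((affine_row l)^T *m affine_row l) + rC (block_mx 0 m m^T X)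
  + 'i%C *: rC (block_mx 0 0 0 1%:M).

Lemma slice_block l m t X : slice l m t X =
  block_mx t%:M (t *: rC l + rC m) (t *: rC l + rC m)^T
    (t *: rC (l^T *m l) + rC X + 'i%C%:M).
Proof.
rewrite /slice /affine_row tr_row_mx trmx1 mul_col_row !map_block_mx !scale_block_mx !add_block_mx.
rewrite !mul1mx !mulmx1 !map_mx0 !map_mx1 !scaler0 !addr0 scalemx1 tr_addmx tr_scalemx !map_trmx.
by rewrite scalemx1.
Qed.

Lemma slice_space l m t X : X^T = X -> 0 < complex.Im t -> siegel_space (slice l m t X).
Proof.
move=> Xs t0; split.
  rewrite slice_block tr_block_mx tr_scalar_mx trmxK !tr_addmx !tr_scalemx !map_trmx Xs.
  by rewrite trmx_mul trmxK tr_scalar_mx.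
have -> : map_mx (@complex.Im R) (slice l m t X) =
    complex.Im t *: ((affine_row l)^T *m affine_row l) + block_mx 0 0 0 1%:M.
  apply/matrixP => i j; rewrite !mxE; case: t {t0} => u v /=.
  by rewrite !mulr0 !add0r mul1r addr0.
split.
  by rewrite tr_addmx tr_scalemx trmx_mul trmxK tr_block_mx !trmx0 trmx1.
move=> v v0; rewrite mulmxDr mulmxDl mxE -scalemxAr -scalemxAl.
set a := v *m (affine_row l)^T.
have -> : v *m ((affine_row l)^T *m affine_row l) *m v^T = a *m a^T.
  by rewrite /a trmx_mul trmxK !mulmxA.
have -> : v *m block_mx 0 0 0 1%:M *m v^T = rsubmx v *m (rsubmx v)^T.
  rewrite -(hsubmxK v) mul_row_block !mulmx0 !mulmx1 !add0r tr_row_mx mul_row_col.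
  by rewrite mul0mx add0r row_mxKr.
have sq k (w : 'rV[R]_k) : (w *m w^T) 0 0 = \sum_i w 0 i ^+ 2.
  by rewrite mxE; apply: eq_bigr => i _; rewrite mxE expr2.
have sq0 k (w : 'rV[R]_k) : 0 <= (w *m w^T) 0 0.
  by rewrite sq sumr_ge0// => i _; rewrite sqr_ge0.
have sq1 k (w : 'rV[R]_k) : w != 0 -> 0 < (w *m w^T) 0 0.
  move=> w0; rewrite lt_def sq0 andbT; apply: contra w0; rewrite sq psumr_eq0 => [|i _]; last exact: sqr_ge0.
  move=> /allP h; apply/eqP/rowP => i; rewrite mxE.
  by have := h i; rewrite mem_index_enum sqrf_eq0 => /(_ isT)/eqP.
rewrite mxE; have [r0|r0] := eqVneq (rsubmx v) 0; last first.
  by rewrite ltr_wpDl ?sq1// mulr_ge0 ?sq0// ltW.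
rewrite r0 mul0mx [X in _ + X]mxE addr0 mulr_gt0// sq1//.
apply: contra v0 => /eqP a0; rewrite -(hsubmxK v) r0.
move: a0; rewrite /a -{1}(hsubmxK v) r0 /affine_row tr_row_mx mul_row_col trmx1 mulmx1 mul0mx addr0.
by move=> ->; rewrite row_mx0.
Qed.

Lemma slice_translation l m t X (k : int) :
  slice l m t X + iC (block_mx k%:M 0 0 0) =
  slice l (m - k%:~R *: l) (t + k%:~R) (X - k%:~R *: (l^T *m l)).
Proof.
have kZ p q (A : 'M[R]_(p, q)) : rC (k%:~R *: A) = k%:~R *: rC A.
  by rewrite map_mxZ rmorph_int.
have kC : iC (k%:M : 'M[int]_1) = k%:~R%:M by rewrite /mx_int_to_C map_scalar_mx.
rewrite !slice_block /mx_int_to_C map_block_mx !map_mx0 -/(mx_int_to_C R _) kC.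
rewrite add_block_mx !addr0 !map_mxB !kZ !scalerDl.
congr block_mx.
- by rewrite raddfD.
- by rewrite addrACA subrr addr0.
- by rewrite addrACA subrr addr0.
- by rewrite addrACA subrr addr0.
Qed.

Definition shear (l : 'rV[int]_n) : 'M[int]_(1 + n) := block_mx 1%:M 0 l^T 1%:M.
Definition shear_dual (l : 'rV[int]_n) : 'M[int]_(1 + n) := block_mx 1%:M (- l) 0 1%:M.

Lemma shear_dualP (l : 'rV[int]_n) : (shear l)^T *m shear_dual l = 1%:M.
Proof.
rewrite /shear /shear_dual tr_block_mx trmxK !trmx1 trmx0 mulmx_block.
rewrite !mul1mx !mulmx1 !mul0mx !mulmx0 !addr0 !add0r addNr.
by rewrite -scalar_mx_block.
Qed.

Lemma slice_shear (k : 'rV[int]_n) l m t X :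
  iC (shear k) *m slice l m t X *m (iC (shear k))^T =
  slice (l + iR k) m t (X + (iR k)^T *m m + m^T *m iR k).
Proof.
have iCE p q (A : 'M[int]_(p, q)) : iC A = rC (iR A).
  by apply/matrixP => i j; rewrite !mxE rmorph_int.
have tU : (rC (iR (shear k)))^T = rC ((iR (shear k))^T) by rewrite map_trmx.
rewrite iCE tU /slice !mulmxDr !mulmxDl -!scalemxAr -!scalemxAl -!map_mxM.
have e : affine_row l *m (iR (shear k))^T = affine_row (l + iR k).
  rewrite /shear map_block_mx map_mx0 !map_mx1 tr_block_mx !trmx1 trmx0 /affine_row.
  rewrite mul_row_block !mulmx1 mulmx0 addr0 mul1mx addrC; congr (row_mx _ _).
  by rewrite map_trmx trmxK.
congr (_ + _ + _).
- by rewrite -e trmx_mul trmxK !mulmxA.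
- congr rC; rewrite /shear map_block_mx map_mx0 !map_mx1 tr_block_mx !trmx1 trmx0.
  rewrite !mulmx_block !mulmx1 !mul1mx !mul0mx !mulmx0 !addr0 !add0r.
  by rewrite !map_trmx trmxK mul0mx add0r addrC [X + _]addrC.
- congr (_ *: rC _); rewrite /shear map_block_mx map_mx0 !map_mx1 tr_block_mx !trmx1 trmx0.
  by do ! rewrite (mulmx_block, mulmx1, mul1mx, mul0mx, mulmx0, addr0, add0r).
Qed.

Lemma slice_inversion l m t X : t != 0 ->
  block_mx (- t^-1)%:M (t^-1 *: (t *: rC l + rC m)) (t^-1 *: (t *: rC l + rC m)^T)
    (t *: rC (l^T *m l) + rC X + 'i%C%:M - t^-1 *: ((t *: rC l + rC m)^T *m (t *: rC l + rC m)))
  = slice (- m) l (- t^-1) (X - l^T *m m - m^T *m l).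
Proof.
move=> t0; rewrite slice_block.
have e : t^-1 *: (t *: rC l + rC m) = - t^-1 *: rC (- m) + rC l.
  by rewrite scalerDr scalerA mulVf// scale1r map_mxN scaleNr scalerN opprK addrC.
congr block_mx => //; first by rewrite -e linearZ.
have -> : (- m)^T *m - m = m^T *m m by rewrite tr_oppmx mulNmx mulmxN opprK.
rewrite tr_addmx tr_scalemx !map_trmx mulmxDl !mulmxDr -!scalemxAr -!scalemxAl !scalerDr !scalerA.
rewrite mulrA mulVf// mul1r !scale1r !map_mxB !map_mxM /=.
move: (rC l^T *m rC l) (rC l^T *m rC m) (rC m^T *m rC l) (rC m^T *m rC m) (rC X) => A B C D E.
by apply/matrixP => a b; rewrite !mxE; ring.
Qed.

Definition affine_form T l : R := (affine_row l *m T *m (affine_row l)^T) 0 0.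

Definition mixed_form T m : R := 2 * (ursubmx T *m m^T) 0 0.

Lemma trace_slice T l m t X : T^T = T ->
  \tr (rC T *m slice l m t X) = t * (affine_form T l)%:C
    + (mixed_form T m + \tr (drsubmx T *m X))%:C + 'i%C * (\tr (drsubmx T))%:C.
Proof.
move=> Ts; rewrite /slice !mulmxDr -!scalemxAr !mxtraceD !mxtraceZ -!map_mxM.
have trC k (A : 'M[R]_k) : \tr (rC A) = (\tr A)%:C.
  by rewrite /mxtrace real_complex_sum; apply: eq_bigr => i _; rewrite mxE.
rewrite !trC; congr (_ * _%:C + _%:C + _ * _%:C).
- by rewrite mulmxA mxtrace_mulC mulmxA /affine_form trace_mx11.
- have dlE : dlsubmx T = (ursubmx T)^T by rewrite trmx_ursub Ts.
  rewrite -{1}(submxK T) mulmx_block !mulmx0 add0r mxtrace_block mxtraceD dlE.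
  rewrite addrA /mixed_form -[\tr (_^T *m m)]mxtrace_tr trmx_mul trmxK mxtrace_mulC.
  by rewrite -mxtrace_mulC trace_mx11 mulrDl mul1r.
- by rewrite -{1}(submxK T) mulmx_block !mulmx0 !mulmx1 !add0r mxtrace_block mxtrace0 add0r.
Qed.

End Slices.

(** * Reduction of quadratic forms *)

Lemma near_integer (R : realType) (x : R) : exists a : int, `|x + a%:~R| <= 1 / 2.
Proof.
exists (- Num.floor (x + 1 / 2)); rewrite mulrNz ler_norml.
have := floor_le (x + 1 / 2); have := floorD1_gt (x + 1 / 2).
by rewrite intrD; move: ((Num.floor _)%:~R) => a; lra.
Qed.

(* With two-step projection the constant 5/8 beats (3/4)^2, which would be too
   small in dimension 5. *)
Lemma two_step_inequality (R : realType) (m B C mu ka nu : R) : 0 < m ->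
  (forall a : int, m <= m * (a%:~R + mu) ^+ 2 + B) ->
  (forall b : int, B <= B * (b%:~R + ka) ^+ 2 + C) ->
  (forall a b : int, m <= m * (a%:~R + b%:~R * mu + nu) ^+ 2 + B * (b%:~R + ka) ^+ 2 + C) ->
  5 / 8 * m <= C.
Proof.
move=> m0 h1 h2 h3; rewrite leNgt; apply/negP => Cm.
have far (x : R) : 1 / 6 < x ^+ 2 -> 2 / 5 < `|x|.
  move=> x2; rewrite ltNge; apply/negP; rewrite ler_norml => /andP[]; nra.
have [a1 ha1] := near_integer mu; have := h1 a1; rewrite addrC.
rewrite (addrC _ mu); set x := mu + _ in ha1 * => hx.
have x2 : x ^+ 2 <= 1 / 4.
  by move: ha1; rewrite ler_norml => /andP[]; nra.
have B34 : 3 / 4 * m <= B by nra.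
have B0 : 0 < B by lra.
have [b0 hb0] := near_integer ka; have := h2 b0; rewrite (addrC _ ka).
set k := ka + _ in hb0 * => hk.
have k2 : k ^+ 2 <= 1 / 4.
  by move: hb0; rewrite ler_norml => /andP[]; nra.
have B56 : B < 5 / 6 * m by nra.
have kk : 1 / 6 < k ^+ 2 by nra.
have xx : 1 / 6 < x ^+ 2 by nra.
pose nu0 := b0%:~R * mu + nu.
have [a2 ha2] := near_integer nu0; have := h3 a2 b0.
rewrite (_ : a2%:~R + _ + nu = nu0 + a2%:~R); last by rewrite /nu0; ring.
rewrite (addrC _ ka) -/k; set y := nu0 + _ in ha2 * => hy.
have Bk : B * k ^+ 2 <= 5 / 24 * m by nra.
have yy : 1 / 6 < y ^+ 2 by nra.
have fx := far x xx; have fy := far y yy; have fk := far k kk.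
(* the neighbour of b0 on the other side of - ka *)
pose sg : int := if 0 <= k then -1 else 1.
have hsk : (k + sg%:~R) ^+ 2 <= 9 / 25.
  rewrite /sg; move: hb0 fk; case: (lerP 0 k) => k0; rewrite ?(ger0_norm k0) ?(ltr0_norm k0) => h f; nra.
have [a3 ha3] : exists a3 : int, (a3%:~R + (y + sg%:~R * x)) ^+ 2 <= 1 / 25.
  have sgx : sg%:~R * x = x \/ sg%:~R * x = - x.
    by rewrite /sg; case: ifP => _; [right|left]; ring.
  move: ha1 ha2 fx fy; rewrite !ler_norml => /andP[x1 x1'] /andP[y1 y1'].
  have nx : `|sg%:~R * x| = `|x| by case: sgx => ->; rewrite ?normrN.
  have b1 : `|sg%:~R * x| <= 1 / 2 by rewrite nx ler_norml x1 x1'.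
  rewrite -nx; move: (sg%:~R * x) b1 => z {nx sgx}.
  rewrite ler_norml => /andP[z1 z1'].
  case: (lerP 0 z) => z0; case: (lerP 0 y) => y0;
    rewrite ?(ger0_norm z0) ?(ltr0_norm z0) ?(ger0_norm y0) ?(ltr0_norm y0) => fz fy'.
  - by exists (-1); nra.
  - by exists 0; nra.
  - by exists 0; nra.
  - by exists 1; nra.
have := h3 (a3 + a2 + sg * a1) (b0 + sg).
have -> : (a3 + a2 + sg * a1)%:~R + (b0 + sg)%:~R * mu + nu =
   a3%:~R + (y + sg%:~R * x) :> R.
  by rewrite /y /x /nu0 !intrD intrM; ring.
have -> : (b0 + sg)%:~R + ka = k + sg%:~R :> R by rewrite /k intrD; ring.
have : B * (k + sg%:~R) ^+ 2 <= 5 / 6 * (9 / 25) * m by nra.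
move: ha3; move: (_ ^+ 2) => u; move: (B * _) => w; nra.
Qed.

Section Reduction.
Variable R : realType.
Local Notation iR := (map_mx (fun z : int => z%:~R : R)).

Definition qform n (Q : 'M[R]_n) (x : 'rV[R]_n) : R := (x *m Q *m x^T) 0 0.

Definition rational_form n (Q : 'M[R]_n) :=
  exists2 N : nat, (0 < N)%N & forall x : 'rV[int]_n, N%:R * qform Q (iR x) \is a Num.int.

Lemma int_rowM m n p (A : 'M[int]_(m, n)) (B : 'M[int]_(n, p)) :
  iR (A *m B) = iR A *m iR B.
Proof. exact: map_mxM. Qed.

Lemma int_row_eq0 m n (A : 'M[int]_(m, n)) : (iR A == 0) = (A == 0).
Proof.
apply/eqP/eqP => [h|->]; last by rewrite map_mx0.
by apply/matrixP => i j; move/matrixP/(_ i j): h; rewrite !mxE => /eqP; rewrite intr_eq0 => /eqP.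
Qed.

Lemma complete_primitive n (r : 'rV[int]_(1 + n)) :
  (forall (c : int) r', r = c *: r' -> c \is a GRing.unit) ->
  exists2 U : 'M[int]_(1 + n), U \in unitmx & row_mx 1%:M 0 *m U = r.
Proof.
move=> prim; have [L uL [V uV [d _ e]]] := int_Smith_normal_form r.
pose c := L 0 0 * d`_0; pose r' := row_mx 1%:M 0 *m V.
have rE : r = c *: r'.
  rewrite e [L]mx11_scalar mul_scalar_mx -scalemxAl /c -scalerA; congr (_ *: _).
  rewrite scalemxAl; congr (_ *m _); apply/rowP => j; rewrite !mxE.
  case: (splitP j) => k jk; rewrite !mxE/=.
    by rewrite jk !ord1 eqxx mulr1.
  by rewrite mulr0 jk.
have uc := prim _ _ rE; exists (c *: V); last by rewrite -scalemxAr rE.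
by rewrite unitmxZ.
Qed.

Lemma minimal_vector n (Q : 'M[R]_n.+1) : posdef Q -> rational_form Q ->
  exists2 e : 'rV[int]_n.+1, e != 0 &
    forall x : 'rV[int]_n.+1, x != 0 -> qform Q (iR e) <= qform Q (iR x).
Proof.
move=> [_ Qpos] [N N0 QN].
have NR : 0 < N%:R :> R by rewrite ltr0n.
pose P k := `[< exists2 x : 'rV[int]_n.+1, x != 0 & N%:R * qform Q (iR x) = k%:R >].
have hP (x : 'rV[int]_n.+1) : x != 0 -> exists2 k : nat, P k & N%:R * qform Q (iR x) = k%:R.
  move=> x0; have := QN x => /intrP[z zE].
  have : 0 <= N%:R * qform Q (iR x).
    by rewrite mulr_ge0 ?(ltW NR)// ltW// Qpos// int_row_eq0.
  rewrite zE ler0z => z0; exists `|z|%N; last by rewrite natr_absz ger0_norm.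
  by apply/asboolP; exists x => //; rewrite zE natr_absz ger0_norm.
have [|k /asboolP[e e0 eE] kmin] := ex_minnP (P := P).
  have [|k Pk _] := hP (const_mx 1); last by exists k.
  by apply/eqP => /rowP/(_ 0); rewrite !mxE => /eqP; rewrite oner_eq0.
exists e => // x x0; have [j Pj jE] := hP x x0.
by rewrite -(ler_pM2l NR) eE jE ler_nat kmin.
Qed.

Record projection_data n (Q : 'M[R]_(1 + n)) (e : 'rV[int]_(1 + n)) := {
  pd_proj : 'M[int]_(1 + n, n);
  pd_lift : 'M[int]_(n, 1 + n);
  pd_coord : 'cV[R]_(1 + n);
  pd_form : 'M[R]_n;
  pd_liftK : pd_lift *m pd_proj = 1%:M;
  pd_kill : e *m pd_proj = 0;
  pd_coord1 : (iR e *m pd_coord) 0 0 = 1;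
  pd_pos : posdef pd_form;
  pd_rat : rational_form pd_form;
  pd_decomp : forall x, qform Q x =
    qform Q (iR e) * ((x *m pd_coord) 0 0) ^+ 2 + qform pd_form (x *m iR pd_proj)
}.

Lemma project_minimal n (Q : 'M[R]_(1 + n)) e : posdef Q -> rational_form Q -> e != 0 ->
  (forall x : 'rV[int]_(1 + n), x != 0 -> qform Q (iR e) <= qform Q (iR x)) ->
  inhabited (projection_data Q e).
Proof.
move=> [Qs Qpos] [N N0 QN] e0 emin.
pose m := qform Q (iR e); have m0 : 0 < m by apply: Qpos; rewrite int_row_eq0.
have [U uU Ue] : exists2 U : 'M[int]_(1 + n), U \in unitmx & row_mx 1%:M 0 *m U = e.
  apply: complete_primitive => c r' rE.
  have c0 : c != 0 by apply: contraNneq e0 => c0; rewrite rE c0 scale0r.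
  have r0 : r' != 0 by apply: contraNneq e0 => r0; rewrite rE r0 scaler0.
  have := emin _ r0; rewrite {1}rE.
  have -> : iR (c *: r') = c%:~R *: iR r' by apply/matrixP => i j; rewrite !mxE intrM.
  have -> : qform Q (c%:~R *: iR r') = (c ^+ 2)%:~R * qform Q (iR r').
    by rewrite /qform linearZ/= -!scalemxAl -scalemxAr scalerA mxE rmorphXn.
  have q0 : 0 < qform Q (iR r') by apply: Qpos; rewrite int_row_eq0.
  rewrite ger_pMl// -[1]/(1%:~R) ler_int => c1.
  by have : (c == 1) || (c == -1) by nia.
pose W := invmx U; have UW : U *m W = 1%:M by rewrite mulmxV.
have WU : W *m U = 1%:M by rewrite mulVmx.
have UWr : iR U *m iR W = 1%:M by rewrite -int_rowM UW map_mx1.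
have WUr : iR W *m iR U = 1%:M by rewrite -int_rowM WU map_mx1.
pose S := iR U *m Q *m (iR U)^T.
have Ss : S^T = S by rewrite /S !trmx_mul trmxK Qs mulmxA.
have SE x : qform Q x = qform S (x *m iR W).
  rewrite /qform; have -> : x *m iR W *m S *m (x *m iR W)^T =
      x *m (iR W *m iR U) *m Q *m (x *m (iR W *m iR U))^T.
    by rewrite /S !trmx_mul !mulmxA.
  by rewrite WUr mulmx1.
pose b := ursubmx S; pose C := drsubmx S.
have Sblock : S = block_mx m%:M b b^T C.
  rewrite -(submxK S) -/b -/C; congr block_mx; last by rewrite /b trmx_ursub Ss.
  rewrite [LHS]mx11_scalar; congr (_%:M).
  rewrite /m SE -Ue int_rowM -mulmxA UWr mulmx1 /qform.
  rewrite map_row_mx map_mx1 map_mx0 -{2}(submxK S) mul_row_block !mul0mx !addr0 !mul1mx.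
  by rewrite tr_row_mx mul_row_col trmx0 mulmx0 addr0 trmx1 mulmx1.
pose Q' := C - m^-1 *: (b^T *m b).
pose al := iR W *m col_mx 1%:M (m^-1 *: b^T).
pose P : 'M[int]_(1 + n, n) := W *m col_mx 0 1%:M.
pose J : 'M[int]_(n, 1 + n) := row_mx 0 1%:M *m U.
have JP : J *m P = 1%:M.
  by rewrite /J /P mulmxA -(mulmxA _ U) UW mulmx1 mul_row_col mul0mx mulmx1 add0r.
have eP : e *m P = 0.
  by rewrite /P -Ue mulmxA -(mulmxA _ U) UW mulmx1 mul_row_col mulmx0 mul0mx addr0.
have ea : (iR e *m al) 0 0 = 1.
  rewrite /al -Ue int_rowM mulmxA -(mulmxA _ (iR U)) UWr mulmx1.
  by rewrite map_row_mx map_mx1 map_mx0 mul_row_col mul0mx addr0 mulmx1 mxE.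
have mxscE (a : R) : (a%:M : 'M[R]_1) 0 0 = a by rewrite mxE eqxx mulr1n.
have mxaddE (A B : 'M[R]_1) : (A + B) 0 0 = A 0 0 + B 0 0 by rewrite mxE.
have mxoppE (A : 'M[R]_1) : (- A) 0 0 = - A 0 0 by rewrite mxE.
have dec x : qform Q x = m * ((x *m al) 0 0) ^+ 2 + qform Q' (x *m iR P).
  rewrite SE /al /P int_rowM !mulmxA map_col_mx map_mx0 map_mx1.
  rewrite -(hsubmxK (x *m iR W)); move: (lsubmx _) (rsubmx _) => y z.
  rewrite !mul_row_col !mulmx0 add0r !mulmx1 [y]mx11_scalar; move: (y 0 0) => {}y.
  rewrite /qform Sblock mul_row_block tr_row_mx mul_row_col tr_scalar_mx.
  set s := (b *m z^T) 0 0; have bz : b *m z^T = s%:M by rewrite [LHS]mx11_scalar.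
  have zb : z *m b^T = s%:M by rewrite -[LHS]trmxK trmx_mul trmxK bz tr_scalar_mx.
  have -> : (z *m Q' *m z^T) 0 0 = (z *m C *m z^T) 0 0 - m^-1 * s ^+ 2.
    rewrite /Q' mulmxBr mulmxBl -scalemxAr -scalemxAl mulmxA -(mulmxA _ b) bz zb.
    by rewrite -scalar_mxM scale_scalar_mx mxaddE mxoppE mxscE expr2.
  rewrite -scalemxAr zb !mulmxDl -(mulmxA y%:M b) bz scale_scalar_mx -!scalar_mxM.
  rewrite !mxaddE !mxscE.
  by move: ((z *m C *m z^T) 0 0) => w; field; rewrite gt_eqF.
have Q's : Q'^T = Q'.
  have Cs : C^T = C by rewrite /C trmx_drsub Ss.
  by rewrite /Q' linearB linearZ/= trmx_mul trmxK Cs.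
have Q'pos : posdef Q'.
  split => // z z0.
  pose y := row_mx (- m^-1 * (b *m z^T) 0 0)%:M z *m iR U.
  have yP : y *m iR P = z.
    rewrite /y /P int_rowM mulmxA -(mulmxA _ (iR U)) UWr mulmx1.
    by rewrite map_col_mx map_mx0 map_mx1 mul_row_col mulmx0 add0r mulmx1.
  have ya : (y *m al) 0 0 = 0.
    rewrite /y /al mulmxA -(mulmxA _ (iR U)) UWr mulmx1 mul_row_col mulmx1.
    have zb : (z *m b^T) = (b *m z^T)^T by rewrite trmx_mul trmxK.
    by rewrite -scalemxAr zb !mxE eqxx mulr1n mulNr addNr.
  have y0 : y != 0 by apply: contraNneq z0 => y0; rewrite -yP y0 mul0mx.
  have := Qpos y y0; rewrite -/(qform Q y) dec ya yP expr0n mulr0 add0r.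
  exact.
exists; apply: (@Build_projection_data _ Q e P J al Q' JP eP ea Q'pos _ dec).
have NR : 0 < N%:R :> R by rewrite ltr0n.
have /intrP[c cE] := QN e; rewrite -/m in cE.
have c0 : 0 < c by rewrite -(ltr0z R) -cE mulr_gt0.
exists (4 * N * `|c|)%N; first by rewrite !muln_gt0 N0 absz_gt0 gt_eqF.
move=> z; pose x := z *m J.
have xP : iR x *m iR P = iR z by rewrite -int_rowM /x -mulmxA JP mulmx1.
have /intrP[a aE] := QN (x + e); have /intrP[k kE] := QN x.
suff -> : (4 * N * `|c|)%:R * qform Q' (iR z) = (4 * c * k - (a - k - c) ^+ 2)%:~R.
  exact: intr_int.
have := dec (iR x); have := dec (iR (x + e)).
have -> : iR (x + e) = iR x + iR e by apply/matrixP => i j; rewrite !mxE intrD.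
rewrite !mulmxDl xP -int_rowM eP map_mx0 addr0 mxE ea.
rewrite -xP; move: aE kE.
have -> : iR (x + e) = iR x + iR e by apply/matrixP => i j; rewrite !mxE intrD.
move: (qform Q _) (qform Q _) (qform Q' _) ((_ *m al) 0 0) => q1 q2 q3 s aE kE e1 e2.
rewrite !natrM natr_absz gtr0_norm// expr2 !(intrB, intrM) -aE -kE -cE e1 e2.
by ring.
Qed.

Definition reducible n (delta : R) := forall (Q : 'M[R]_n) (A : R),
  posdef Q -> rational_form Q -> 0 < A ->
  (forall x : 'rV[int]_n, x != 0 -> A <= qform Q (iR x)) ->
  exists (l : 'cV[int]_n) (w : 'rV[int]_n), w *m l = 1%:M /\
    forall x : 'rV[R]_n, delta * A * ((x *m iR l) 0 0) ^+ 2 <= qform Q x.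

Lemma reducible_le n (d d' : R) : d' <= d -> reducible n d -> reducible n d'.
Proof.
move=> dd h Q A Qp Qr A0 /(h Q A Qp Qr A0)[l [w [wl hl]]].
exists l, w; split => // x; apply: le_trans (hl x).
by rewrite ler_wpM2r ?sqr_ge0// ler_wpM2r// ltW.
Qed.

Lemma reducible1 : reducible 1 1.
Proof.
move=> Q A _ _ A0 hA; exists 1%:M, 1%:M; split; first by rewrite mulmx1.
move=> x; rewrite map_mx1 mulmx1 mul1r [x]mx11_scalar mxE eqxx mulr1n /qform.
rewrite mul_scalar_mx tr_scalar_mx mul_mx_scalar scalerA mxE -expr2 mulrC.
rewrite ler_wpM2l ?sqr_ge0// (le_trans (hA 1%:M _))//.
  by apply/eqP => /matrixP/(_ 0 0); rewrite !mxE => /eqP; rewrite oner_eq0.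
by rewrite /qform map_mx1 mul1mx trmx1 mulmx1.
Qed.

Lemma qform_ge0 n (Q : 'M[R]_n) x : posdef Q -> 0 <= qform Q x.
Proof.
move=> [_ h]; have [->|/h/ltW//] := eqVneq x 0.
by rewrite /qform !mul0mx mxE.
Qed.

Lemma int_row_neq0_proj n p (x : 'rV[int]_n) (P : 'M[int]_(n, p)) y :
  x *m P = y -> y != 0 -> x != 0.
Proof. by move=> <-; apply: contraNneq => ->; rewrite mul0mx. Qed.

Lemma mx11_intM n (x : 'rV[int]_n) (y : 'rV[int]_n) (c : 'cV[R]_n) (a : int) :
  (iR (x + a *: y) *m c) 0 0 = (iR x *m c) 0 0 + a%:~R * (iR y *m c) 0 0.
Proof.
have -> : iR (x + a *: y) = iR x + a%:~R *: iR y.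
  by apply/matrixP => i j; rewrite !mxE intrD intrM.
by rewrite mulmxDl -scalemxAl !mxE.
Qed.

Lemma reducible_step1 n d : 0 <= d -> reducible n d -> reducible (1 + n) (3 / 4 * d).
Proof.
move=> d0 IH Q A Qp Qr A0 hA; have [e e0 emin] := minimal_vector Qp Qr.
have [D] := project_minimal Qp Qr e0 emin.
set m := qform Q (iR e) in emin; have Am : A <= m by apply: hA.
have := IH (pd_form D) (3 / 4 * m) (pd_pos D) (pd_rat D).
case => [|x' x'0|l [w [wl hl]]]; first by lra.
  pose x := x' *m pd_lift D.
  have xP : x *m pd_proj D = x' by rewrite /x -mulmxA pd_liftK mulmx1.
  have [a ha] := near_integer ((iR x *m pd_coord D) 0 0).
  have y0 : x + a *: e != 0.
    apply: (@int_row_neq0_proj _ _ _ (pd_proj D) x') => //.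
    by rewrite mulmxDl xP -scalemxAl pd_kill scaler0 addr0.
  have := emin _ y0; rewrite (pd_decomp D) -/m mx11_intM pd_coord1 mulr1 -int_rowM.
  rewrite mulmxDl xP -scalemxAl pd_kill scaler0 addr0.
  move: ha; rewrite ler_norml => /andP[]; move: (_ + a%:~R) => u u1 u2 h.
  have : u ^+ 2 <= 1 / 4 by nra.
  by move: h; move: (qform _ _) (u ^+ 2) => q v; nra.
exists (pd_proj D *m l), (w *m pd_lift D); split.
  by rewrite mulmxA -(mulmxA w) pd_liftK mulmx1.
move=> x; rewrite (pd_decomp D x) -/m int_rowM mulmxA.
have h := hl (x *m iR (pd_proj D)).
have h' : 0 <= m * ((x *m pd_coord D) 0 0) ^+ 2 by rewrite mulr_ge0 ?sqr_ge0//; lra.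
move: h h'; move: (qform _ _) (m * _ ^+ 2) => q v h h'.
have : 3 / 4 * d * A * ((x *m iR (pd_proj D) *m iR l) 0 0) ^+ 2 <=
    d * (3 / 4 * m) * ((x *m iR (pd_proj D) *m iR l) 0 0) ^+ 2.
  by rewrite ler_wpM2r ?sqr_ge0//; nra.
by lra.
Qed.

Lemma reducible_step2 n d : 0 <= d -> reducible n d -> reducible (1 + (1 + n)) (5 / 8 * d).
Proof.
move=> d0 IH Q A Qp Qr A0 hA; have [e e0 emin] := minimal_vector Qp Qr.
have [D] := project_minimal Qp Qr e0 emin.
set m := qform Q (iR e) in emin; have Am : A <= m by apply: hA.
have [f f0 fmin] := minimal_vector (pd_pos D) (pd_rat D).
have [E] := project_minimal (pd_pos D) (pd_rat D) f0 fmin.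
set B := qform (pd_form D) (iR f) in fmin.
have lift (z : 'rV[int]_(1 + n)) a : z != 0 ->
    m <= m * (a%:~R + (iR (z *m pd_lift D) *m pd_coord D) 0 0) ^+ 2 + qform (pd_form D) (iR z).
  move=> z0; pose x := z *m pd_lift D.
  have yP : (x + a *: e) *m pd_proj D = z.
    by rewrite mulmxDl -scalemxAl pd_kill scaler0 addr0 /x -mulmxA pd_liftK mulmx1.
  have := emin _ (int_row_neq0_proj yP z0).
  by rewrite (pd_decomp D) -/m mx11_intM pd_coord1 mulr1 -int_rowM yP addrC [_%:~R + _]addrC [X in _ -> _ <= X]addrC.
have := IH (pd_form E) (5 / 8 * m) (pd_pos E) (pd_rat E).
case => [|x'' x''0|l [w [wl hl]]]; first by lra.
  pose y := x'' *m pd_lift E.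
  have yP b : (y + b *: f) *m pd_proj E = x''.
    by rewrite mulmxDl -scalemxAl pd_kill scaler0 addr0 /y -mulmxA pd_liftK mulmx1.
  have qy b : qform (pd_form D) (iR (y + b *: f)) =
      B * (b%:~R + (iR y *m pd_coord E) 0 0) ^+ 2 + qform (pd_form E) (iR x'').
    by rewrite (pd_decomp E) -/B mx11_intM pd_coord1 mulr1 -int_rowM yP [X in X ^+ 2]addrC.
  apply: (@two_step_inequality _ m B _ ((iR (f *m pd_lift D) *m pd_coord D) 0 0)
    ((iR y *m pd_coord E) 0 0) ((iR (y *m pd_lift D) *m pd_coord D) 0 0)).
  - by lra.
  - by move=> a; apply: lift.
  - by move=> b; rewrite -qy; apply: fmin; exact: int_row_neq0_proj (yP b) x''0.
  - move=> a b; have := lift _ a (int_row_neq0_proj (yP b) x''0).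
    by rewrite qy mulmxDl -scalemxAl mx11_intM [X in a%:~R + X]addrC !addrA.
exists (pd_proj D *m (pd_proj E *m l)), (w *m pd_lift E *m pd_lift D); split.
  by rewrite mulmxA -(mulmxA _ (pd_lift D)) pd_liftK mulmx1 mulmxA -(mulmxA w) pd_liftK mulmx1.
move=> x; rewrite (pd_decomp D x) -/m (pd_decomp E) -/B !int_rowM !mulmxA.
have h := hl (x *m iR (pd_proj D) *m iR (pd_proj E)).
have h' : 0 <= m * ((x *m pd_coord D) 0 0) ^+ 2 by rewrite mulr_ge0 ?sqr_ge0//; lra.
have h'' : 0 <= B * ((x *m iR (pd_proj D) *m pd_coord E) 0 0) ^+ 2.
  by rewrite mulr_ge0 ?sqr_ge0// qform_ge0//; exact: pd_pos.
move: h h' h''; move: (qform _ _) (m * _ ^+ 2) (B * _ ^+ 2) => q v v' h h' h''.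
have : 5 / 8 * d * A * ((x *m iR (pd_proj D) *m iR (pd_proj E) *m iR l) 0 0) ^+ 2 <=
    d * (5 / 8 * m) * ((x *m iR (pd_proj D) *m iR (pd_proj E) *m iR l) 0 0) ^+ 2.
  by rewrite ler_wpM2r ?sqr_ge0//; nra.
by lra.
Qed.

Lemma reducible_le5 n : (n < 5)%N -> reducible (1 + n) (25 / 64).
Proof.
case: n => [|[|[|[|[|//]]]]] _.
- by apply: reducible_le reducible1; lra.
- by apply: reducible_le (reducible_step1 _ reducible1); lra.
- by apply: reducible_le (reducible_step2 _ reducible1); lra.
- by apply: reducible_le (reducible_step1 _ (reducible_step2 _ reducible1)); lra.
- by apply: reducible_le (reducible_step2 _ (reducible_step2 _ reducible1)); lra.
Qed.

End Reduction.

Lemma sin_le_id (R : realType) (x : R) : 0 <= x -> sin x <= x.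
Proof.
move=> x0; rewrite -subr_ge0.
pose F (y : R) := y - sin y.
have dF (y : R) : is_derive y 1 F (1 - cos y) by apply: is_deriveB.
have : F 0 <= F x.
  apply: (@ger0_derive1_le_cc _ F 0 x) => //.
  - move=> y _; have [_ e] := dF y; rewrite derive1E e.
    by rewrite subr_ge0 cos_le1.
  - by apply: derivable_within_continuous => y _; case: (dF y).
  - by rewrite in_itv/= lexx.
  - by rewrite in_itv/= lexx andbT.
by rewrite /F sin0 subrr.
Qed.

Lemma pi_ge3 (R : realType) : 3 <= pi :> R.
Proof.
have cosE (x : R) : 0 <= x -> x <= 1 -> 1 - 2 * x ^+ 2 <= cos (x *+ 2).
  move=> x0 x1; rewrite cos_mulr2n; have := cos2Dsin2 x; have := sin_le_id x0.
  have : 0 <= sin x by apply: sin_ge0_pi; rewrite x0/= (le_trans x1)// (le_trans _ (pi_ge2 _))// ler1n.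
  by move: (sin x) (cos x) => s c; nra.
have c34 : 23 / 32 <= cos (3 / 4 : R).
  have -> : 3 / 4 = (3 / 8) *+ 2 :> R by rewrite -mulr_natr; field.
  by apply: le_trans (cosE _ _ _); lra.
have c32 : 0 < cos (3 / 2 : R).
  have -> : 3 / 2 = (3 / 4) *+ 2 :> R by rewrite -mulr_natr; field.
  by rewrite cos_mulr2n; move: c34; move: (cos _) => c; nra.
rewrite leNgt; apply/negP => pi3; have := pi_ge2 R => pi2.
have : cos (3 / 2) < cos (pi / 2) :> R.
  by rewrite ltr_cos ?in_itv/=; [lra | apply/andP; split; lra | apply/andP; split; lra].
by rewrite cos_pihalf ltNge (ltW c32).
Qed.

(** * Uniqueness of Fourier expansions *)

Section Coordinates.
Variable R : realType.

Definition half_coord k (T : 'M[R]_k) : {ffun 'I_k * 'I_k -> int} :=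
  [ffun ij => if ij.1 == ij.2 then Num.floor (T ij.1 ij.2)
              else if (ij.1 < ij.2)%N then Num.floor (2 * T ij.1 ij.2) else 0].

Definition sym_mx k (x : 'I_k * 'I_k -> R) : 'M[R]_k :=
  \matrix_(i, j) if (i <= j)%N then x (i, j) else x (j, i).

Lemma sym_mxT k (x : 'I_k * 'I_k -> R) : (sym_mx x)^T = sym_mx x.
Proof.
apply/matrixP => i j; rewrite !mxE; case: ltngtP => // ij.
by have -> : i = j by apply: val_inj.
Qed.

Lemma half_coord_diag k (T : 'M[R]_k) i : half_integral T ->
  (half_coord T (i, i))%:~R = T i i.
Proof. by move=> [_ h _]; rewrite ffunE/= eqxx floorK. Qed.

Lemma half_coord_off k (T : 'M[R]_k) (i j : 'I_k) : half_integral T -> (i < j)%N ->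
  (half_coord T (i, j))%:~R = 2 * T i j.
Proof.
move=> [_ _ h] ij; rewrite ffunE/= ij -val_eqE/= ltn_eqF// floorK//.
Qed.

Lemma half_coord_trace k (T : 'M[R]_k) x : half_integral T ->
  \tr (T *m sym_mx x) = \sum_ij (half_coord T ij)%:~R * x ij.
Proof.
move=> hT; have [Ts _ _] := hT.
have Tji i j : T j i = T i j by rewrite -{1}Ts mxE.
transitivity (\sum_i \sum_j (half_coord T (i, j))%:~R * x (i, j)); last first.
  by rewrite pair_bigA; apply: eq_bigr => -[].
pose P (i j : 'I_k) := if (i <= j)%N then T i j * x (i, j) else 0.
pose Q (i j : 'I_k) := if (i < j)%N then T i j * x (i, j) else 0.
transitivity (\sum_i \sum_j P i j + \sum_i \sum_j Q i j).
  rewrite [X in _ + X]exchange_big/= -big_split/=; apply: eq_bigr => i _.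
  rewrite mxE -big_split/=; apply: eq_bigr => j _; rewrite mxE /P /Q.
  case: ltngtP => ij; rewrite ?addr0 ?add0r ?(Tji i j)//.
  by have -> : i = j by apply: val_inj.
rewrite -big_split/=; apply: eq_bigr => i _; rewrite -big_split/=.
apply: eq_bigr => j _; rewrite /P /Q; case: (ltngtP i j) => ij.
- by rewrite half_coord_off//; ring.
- by rewrite ffunE/= -val_eqE/= gtn_eqF// ltnNge ltnW//= mul0r addr0.
- have <- : i = j by apply: val_inj.
  by rewrite half_coord_diag// addr0.
Qed.

Lemma half_coord_inj k (T T' : 'M[R]_k) : half_integral T -> half_integral T' ->
  half_coord T = half_coord T' -> T = T'.
Proof.
move=> hT hT' e; have [Ts _ _] := hT; have [Ts' _ _] := hT'.
have up (i j : 'I_k) : (i <= j)%N -> T i j = T' i j.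
  rewrite leq_eqVlt => /orP[/eqP ij|ij].
    have <- : i = j by apply: val_inj.
    by rewrite -!half_coord_diag// e.
  by apply: (@mulfI _ (2 : R)) => //; rewrite -!half_coord_off// e.
apply/matrixP => i j; case: (leqP i j) => [/up//|/ltnW/up h].
by rewrite -Ts -Ts' !mxE h.
Qed.

Definition int_valued_form k (T : 'M[R]_k) := forall x : 'rV[int]_k,
  qform T (map_mx (fun z : int => z%:~R : R) x) \is a Num.int.

Lemma half_integral_qform k (T : 'M[R]_k) : half_integral T -> int_valued_form T.
Proof.
move=> hT x; set y := map_mx _ x.
have -> : qform T y = \tr (T *m sym_mx (fun ij => y 0 ij.1 * y 0 ij.2)).
  have -> : sym_mx (fun ij => y 0 ij.1 * y 0 ij.2) = y^T *m y.
    apply/matrixP => i j; rewrite !mxE big_ord1 !mxE /=; case: ifP => //.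
    by rewrite mulrC.
  by rewrite mulmxA mxtrace_mulC mulmxA trace_mx11.
rewrite half_coord_trace// rpred_sum// => ij _.
by rewrite !mxE rpredM ?rpredM ?intr_int.
Qed.

Lemma qform_half_integral k (T : 'M[R]_k) : T^T = T -> int_valued_form T ->
  half_integral T.
Proof.
move=> Ts h.
have hq i j (a b : int) : a%:~R ^+ 2 * T i i + 2 * a%:~R * b%:~R * T i j + b%:~R ^+ 2 * T j j
    \is a Num.int.
  have := h (a *: delta_mx 0 i + b *: delta_mx 0 j); congr (_ \is a _).
  have -> : map_mx (fun z : int => z%:~R : R) (a *: delta_mx 0 i + b *: delta_mx 0 j) =
      a%:~R *: delta_mx 0 i + b%:~R *: delta_mx 0 j :> 'rV[R]_k.
    by apply/matrixP => p q; rewrite !mxE intrD !intrM !rmorph_nat.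
  have dT p q : (delta_mx 0 p : 'rV[R]_k) *m T *m (delta_mx 0 q)^T = (T p q)%:M.
    by rewrite -rowE trmx_delta -colE; apply/matrixP => u v; rewrite !ord1 !mxE mulr1n.
  have Tji : T j i = T i j by rewrite -{1}Ts mxE.
  have trD : (a%:~R *: delta_mx 0 i + b%:~R *: delta_mx 0 j : 'rV[R]_k)^T =
      a%:~R *: (delta_mx 0 i)^T + b%:~R *: (delta_mx 0 j)^T.
    by rewrite linearD !linearZ.
  rewrite /qform trD !mulmxDl !mulmxDr -!scalemxAl -!scalemxAr !dT.
  by rewrite Tji !scale_scalar_mx !mxE !mulr1n; ring.
split => // i; first by have := hq i i 1 0; congr (_ \is a _); ring.
move=> j; have h1 := hq i j 1 1; have h2 := hq i j 1 0; have h3 := hq i j 0 1.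
suff -> : 2 * T i j = (1%:~R ^+ 2 * T i i + 2 * 1%:~R * 1%:~R * T i j + 1%:~R ^+ 2 * T j j)
    - (1%:~R ^+ 2 * T i i + 2 * 1%:~R * 0%:~R * T i j + 0%:~R ^+ 2 * T j j)
    - (0%:~R ^+ 2 * T i i + 2 * 0%:~R * 1%:~R * T i j + 1%:~R ^+ 2 * T j j).
  exact: rpredB (rpredB h1 h2) h3.
by ring.
Qed.

End Coordinates.

Section Uniqueness.
Variables (R : realType) (g : nat).
Implicit Types (a : 'M[R]_g -> R[i]) (h : 'M[R[i]]_g -> R[i]).

Definition fourier_family h a :=
  (forall T, a T != 0 -> half_integral T) /\
  forall tau, siegel_space tau -> has_sum (fun T =>
    a T * cexp ((0 +i* pi) * \tr (map_mx (real_complex R) T *m tau))) (h tau).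

Lemma fourier_expansion_family h a : fourier_expansion h a -> fourier_family h a.
Proof. by move=> [ha hs]; split => // tau Ht; apply: has_sumP; apply: hs. Qed.

Definition base_point (X : 'M[R]_g) : 'M[R[i]]_g :=
  map_mx (real_complex R) X + 'i%C%:M.

Lemma base_point_space X : X^T = X -> siegel_space (base_point X).
Proof.
move=> Xs; split; first by rewrite /base_point linearD/= map_trmx Xs tr_scalar_mx.
have -> : map_mx (@complex.Im R) (base_point X) = 1%:M.
  by apply/matrixP => i j; rewrite !mxE; case: eqP => _ /=; rewrite ?mulr1n ?mulr0n /= add0r.
split => [|v v0]; first exact: trmx1.
rewrite mulmx1 lt_def mxE; apply/andP; split; last first.
  by apply: sumr_ge0 => i _; rewrite mxE -expr2 sqr_ge0.
apply: contra v0; rewrite psumr_eq0 => [/allP h|i _]; last by rewrite mxE -expr2 sqr_ge0.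
apply/eqP/rowP => i; rewrite mxE.
by have := h i; rewrite mem_index_enum mxE -expr2 sqrf_eq0 => /(_ isT)/eqP.
Qed.

Lemma cexp_base_point T X :
  cexp ((0 +i* pi) * \tr (map_mx (real_complex R) T *m base_point X)) =
  (expR (- (pi * \tr T)))%:C * ee (\tr (T *m X)).
Proof.
have -> : \tr (map_mx (real_complex R) T *m base_point X) =
    (\tr (T *m X)) +i* (\tr T).
  rewrite /base_point mulmxDr mxtraceD mul_mx_scalar mxtraceZ -map_mxM.
  have trC k (A : 'M[R]_k) : \tr (map_mx (real_complex R) A) = (\tr A)%:C.
    by rewrite /mxtrace real_complex_sum; apply: eq_bigr => i _; rewrite mxE.
  by rewrite !trC; apply/eqP; rewrite eq_complex/=; apply/andP; split; apply/eqP; ring.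
rewrite /ee -[(expR _)%:C]mulr1.
have -> : ((0 : R) +i* pi) * ((\tr (T *m X)) +i* (\tr T)) =
   (- (pi * \tr T))%:C + (0 +i* (pi * \tr (T *m X))).
  by apply/eqP; rewrite eq_complex/=; apply/andP; split; apply/eqP; ring.
by rewrite cexpD {1}/cexp/= cos0 sin0.
Qed.

Lemma has_sum_single (K : choiceType) (c : K -> R[i]) k :
  has_sum (fun j => if j == k then c j else 0) (c k).
Proof.
move=> e e0; exists [fset k]%fset => F; rewrite fsub1set => kF.
rewrite (big_fsetD1 k)//= eqxx big1_seq ?addr0 ?subrr ?normc0//.
by move=> j; rewrite !inE => /and3P[_ /negbTE ->].
Qed.

Lemma fourier_unique h h' a a' :
  (forall tau, siegel_space tau -> h tau = h' tau) ->
  fourier_family h a -> fourier_family h' a' -> a = a'.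
Proof.
move=> hh' ha ha'; have [ia sa] := ha; have [ia' sa'] := ha'.
apply/funext => T0.
pose c T := (a T - a' T) * (expR (- (pi * \tr T)))%:C.
have cint T : c T != 0 -> half_integral T.
  rewrite mulf_eq0 negb_or => /andP[aa' _].
  have [a0|/ia//] := eqVneq (a T) 0; apply: ia'.
  by apply: contra aa' => /eqP ->; rewrite a0 subrr.
have cs X : X^T = X -> has_sum (fun T => c T * ee (\tr (T *m X))) 0.
  move=> Xs; have HX := base_point_space Xs.
  have := has_sumB (sa _ HX) (sa' _ HX).
  rewrite hh'// subrr; congr has_sum; apply/funext => T.
  by rewrite !cexp_base_point /c; ring.
have [B cB] := has_sum_bounded (cs 0 (trmx0 _ _ _)).
have {}cB : abs_bounded c B.
  by apply: abs_boundedW cB => T; rewrite [leRHS]normcM normc_ee mulr1.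
have [T0i|nT0] := pselect (half_integral T0); last first.
  have [/eqP ->|/ia//] := boolP (a T0 == 0).
  by have [/eqP ->|/ia'//] := boolP (a' T0 == 0).
have : normc (c T0) <= 0.
  apply: (@fiber_bound R _ _ c (@half_coord R g) B 0 cB _ (half_coord T0)) => [x _|].
    exists 0; last by rewrite normc0.
    have := cs _ (sym_mxT x); congr has_sum; apply/funext => T.
    have [->|/cint hT] := eqVneq (c T) 0; first by rewrite !mul0r.
    by rewrite half_coord_trace.
  have := has_sum_single c T0; congr has_sum; apply/funext => T.
  case: (eqVneq T T0) => [->|TT0]; first by rewrite eqxx.
  case: eqP => // e; apply/eqP; rewrite eq_sym; apply: contraNT TT0 => /cint hT.
  by apply/eqP/half_coord_inj.
move=> c0; have /eq0_normc/eqP : normc (c T0) = 0.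
  by apply/eqP; rewrite eq_le c0 normc_ge0.
rewrite mulf_eq0 => /orP[|]; first by rewrite subr_eq0 => /eqP.
by rewrite eq_complex/= eqxx andbT gt_eqF// expR_gt0.
Qed.

End Uniqueness.

(** * Fourier-Jacobi coefficients *)

Section FourierJacobi.
Variables (R : realType) (n : nat).
Local Notation rC := (map_mx (real_complex R)).
Local Notation iR := (map_mx (fun z : int => z%:~R : R)).
Variable f : 'M[R[i]]_(1 + n) -> R[i].
Variable a : 'M[int]_((1 + n) + (1 + n)) -> 'M[R]_(1 + n) -> R[i].
Hypothesis aF : forall M, Sp_int M -> fourier_expansion (slash 2 M f) (a M).
Implicit Types (M : 'M[int]_((1 + n) + (1 + n))) (l m : 'rV[R]_n) (t : R[i])
  (T : 'M[R]_(1 + n)) (X : 'M[R]_n).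

Lemma half_integral_drsub T : half_integral T -> half_integral (drsubmx T).
Proof.
move=> [Ts h1 h2]; split => [|i|i j]; first by rewrite trmx_drsub Ts.
  by rewrite !mxE; exact: h1.
by rewrite !mxE; exact: h2.
Qed.

Definition slice_term M l m t T : R[i] :=
  a M T * (cexp ((0 +i* pi) * (t * (affine_form T l)%:C)) * ee (mixed_form T m)).

Lemma normc_slice_term M l m t T : normc (slice_term M l m t T) =
  normc (a M T) * expR (- (pi * (complex.Im t * affine_form T l))).
Proof.
rewrite normcM normcM normc_ee mulr1 normc_cexp; congr (_ * expR _).
by case: t => u v /=; ring.
Qed.

Lemma slice_has_sum M l m t X : Sp_int M -> X^T = X -> 0 < complex.Im t ->
  has_sum (fun T => slice_term M l m t T * (expR (- (pi * \tr (drsubmx T))))%:C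
                    * ee (\tr (drsubmx T *m X)))
    (slash 2 M f (slice l m t X)).
Proof.
move=> SpM Xs t0; have Ht := slice_space l m Xs t0.
have [_ /(_ _ Ht)] := fourier_expansion_family (aF SpM); congr has_sum; apply/funext => T.
have [a0|aT] := eqVneq (a M T) 0; first by rewrite /slice_term a0 !mul0r.
have [/(_ _ aT)[Ts _ _] _] := aF SpM.
rewrite /slice_term trace_slice//.
have -> : (0 +i* pi) * (t * (affine_form T l)%:C
      + (mixed_form T m + \tr (drsubmx T *m X))%:C + 'i%C * (\tr (drsubmx T))%:C) =
    (0 +i* pi) * (t * (affine_form T l)%:C) +
    ((0 +i* (pi * (mixed_form T m + \tr (drsubmx T *m X)))) + (- (pi * \tr (drsubmx T)))%:C).
  case: t {t0 Ht} => u v; apply/eqP; rewrite eq_complex/=; apply/andP; split; apply/eqP; ring.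
rewrite !cexpD cexp_real -/(ee (mixed_form T m + \tr (drsubmx T *m X))) eeD.
by move: (cexp _) (ee _) (ee _) => z1 z2 z3; ring.
Qed.

Variable T' : 'M[R]_n.

Definition on_fiber (c : 'M[R]_(1 + n) -> R[i]) T := if drsubmx T == T' then c T else 0.

Lemma fiber_bounded M l m t : Sp_int M -> 0 < complex.Im t ->
  exists B, abs_bounded (on_fiber (slice_term M l m t)) B.
Proof.
move=> SpM t0; have [B hB] := has_sum_bounded (slice_has_sum l m SpM (trmx0 _ _ _) t0).
pose e := expR (- (pi * \tr T')); have e0 : 0 < e by apply: expR_gt0.
exists (B / e) => F; rewrite ler_pdivlMr// mulr_suml (le_trans _ (hB F))//.
apply: ler_sum => T _; rewrite /on_fiber; case: eqP => [TT'|_].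
  by rewrite [leRHS]normcM normc_ee mulr1 [leRHS]normcM normc_real TT' -/e gtr0_norm.
by rewrite normc0 mul0r normc_ge0.
Qed.

Definition jacobi_value M l m t : R[i] :=
  xget 0 [set s | has_sum (on_fiber (slice_term M l m t)) s].

Lemma jacobi_has_sum M l m t : Sp_int M -> 0 < complex.Im t ->
  has_sum (on_fiber (slice_term M l m t)) (jacobi_value M l m t).
Proof.
move=> SpM t0; have [B hB] := fiber_bounded l m SpM t0.
have [s hs] := abs_bounded_has_sum hB.
by rewrite /jacobi_value; case: xgetP => // h; case: (h s).
Qed.

Hypothesis T'half : half_integral T'.

Lemma jacobi_transfer M M1 l m t l1 m1 t1 ka X0 : Sp_int M -> Sp_int M1 ->
  0 < complex.Im t -> 0 < complex.Im t1 -> X0^T = X0 ->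
  (forall X, X^T = X -> slash 2 M f (slice l m t X) =
    ka * slash 2 M1 f (slice l1 m1 t1 (X + X0))) ->
  normc (jacobi_value M l m t) = normc ka * normc (jacobi_value M1 l1 m1 t1).
Proof.
move=> SpM SpM1 t0 t10 X0s h.
pose E T := (expR (- (pi * \tr (drsubmx T))))%:C : R[i].
pose d T := slice_term M l m t T * E T -
  ka * (slice_term M1 l1 m1 t1 T * E T * ee (\tr (drsubmx T *m X0))).
have dsum X : X^T = X -> has_sum (fun T => d T * ee (\tr (drsubmx T *m X))) 0.
  move=> Xs; have XX0 : (X + X0)^T = X + X0 by rewrite tr_addmx Xs X0s.
  have := has_sumB (slice_has_sum l m SpM Xs t0)
    (has_sumZ ka (slice_has_sum l1 m1 SpM1 XX0 t10)).
  rewrite h// subrr; congr has_sum; apply/funext => T.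
  by rewrite /d mulmxDr mxtraceD eeD; rewrite /E; ring.
have [B dB] := has_sum_bounded (dsum 0 (trmx0 _ _ _)).
have {}dB : abs_bounded d B.
  by apply: abs_boundedW dB => T; rewrite [leRHS]normcM normc_ee mulr1.
have dint T : d T != 0 -> half_integral T.
  have [h1 _] := aF SpM; have [h2 _] := aF SpM1 => dT.
  have [a0|/h1//] := eqVneq (a M T) 0; apply: h2; apply: contra dT => /eqP a10.
  by rewrite /d /slice_term a0 a10 !mul0r mulr0 subr0.
pose s := (jacobi_value M l m t - ka * ee (\tr (T' *m X0)) * jacobi_value M1 l1 m1 t1) *
  (expR (- (pi * \tr T')))%:C.
have s0 : normc s <= 0.
  apply: (@fiber_bound R _ _ d (fun T => half_coord (drsubmx T)) B 0 dB _ (half_coord T')).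
    move=> x _; exists 0; last by rewrite normc0.
    have := dsum _ (sym_mxT x); congr has_sum; apply/funext => T.
    have [->|/dint/half_integral_drsub hT] := eqVneq (d T) 0; first by rewrite !mul0r.
    by rewrite half_coord_trace.
  have := has_sumZ (expR (- (pi * \tr T')))%:C (has_sumB (jacobi_has_sum l m SpM t0)
    (has_sumZ (ka * ee (\tr (T' *m X0))) (jacobi_has_sum l1 m1 SpM1 t10))).
  rewrite [_ * (jacobi_value _ _ _ _ - _)]mulrC -/s.
  congr has_sum; apply/funext => T; rewrite /on_fiber.
  have [TT|TT'] := eqVneq (drsubmx T) T'.
    by rewrite TT eqxx /d /E TT; move: (slice_term _ _ _ _ _) => u; ring.
  rewrite mulr0 subr0 mulr0; case: eqP => // e; apply/eqP; rewrite eq_sym.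
  apply: contraNT TT' => /dint/half_integral_drsub hT.
  by apply/eqP/half_coord_inj.
have /eq0_normc/eqP : normc s = 0 by apply/eqP; rewrite eq_le s0 normc_ge0.
rewrite mulf_eq0 => /orP[|]; last by rewrite eq_complex/= eqxx andbT gt_eqF// expR_gt0.
by rewrite subr_eq0 => /eqP ->; rewrite normcM (normcM ka) normc_ee mulr1.
Qed.

Definition first_translation (k : int) : 'M[int]_((1 + n) + (1 + n)) :=
  translation_mx (block_mx k%:M 0 0 0).

Definition shear_levi (k : 'rV[int]_n) : 'M[int]_((1 + n) + (1 + n)) :=
  levi_mx (shear k) (shear_dual k).

Lemma first_translation_Sp k : Sp_int (first_translation k).
Proof. by apply: translation_Sp; rewrite tr_block_mx tr_scalar_mx !trmx0. Qed.

Lemma shear_levi_Sp k : Sp_int (shear_levi k).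
Proof. exact/levi_Sp/shear_dualP. Qed.

Lemma Im_translate t (k : int) : complex.Im (t + k%:~R) = complex.Im t.
Proof.
have -> : (k%:~R : R[i]) = (k%:~R)%:C by rewrite rmorph_int.
by case: t => u v /=; rewrite addr0.
Qed.

Lemma jacobi_translation M l m t k : Sp_int M -> 0 < complex.Im t ->
  normc (jacobi_value (M *m first_translation k) l m t) =
  normc (jacobi_value M l (m - k%:~R *: l) (t + k%:~R)).
Proof.
move=> SpM t0; have SpT := first_translation_Sp k.
have t10 : 0 < complex.Im (t + k%:~R) by rewrite Im_translate.
have X0s : (- (k%:~R *: (l^T *m l)))^T = - (k%:~R *: (l^T *m l)).
  by rewrite tr_oppmx tr_scalemx trmx_mul trmxK.
rewrite (@jacobi_transfer _ _ l m t l (m - k%:~R *: l) _ 1 _ (Sp_int_mul SpM SpT) SpM t0 t10 X0s).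
  by rewrite normc1 mul1r.
move=> X Xs; rewrite mul1r -slice_translation; apply: slash_translation => //.
  by rewrite tr_block_mx tr_scalar_mx !trmx0.
exact: slice_space.
Qed.

Lemma jacobi_shear M l m t k : Sp_int M -> 0 < complex.Im t ->
  normc (jacobi_value (M *m shear_levi k) l m t) =
  normc (jacobi_value M (l + iR k) m t).
Proof.
move=> SpM t0; have SpL := shear_levi_Sp k.
have X0s : ((iR k)^T *m m + m^T *m iR k)^T = (iR k)^T *m m + m^T *m iR k.
  by rewrite tr_addmx !trmx_mul !trmxK addrC.
rewrite (@jacobi_transfer _ _ l m t (l + iR k) m _ 1 _ (Sp_int_mul SpM SpL) SpM t0 t0 X0s).
  by rewrite normc1 mul1r.
move=> X Xs; rewrite mul1r addrA -slice_shear; apply: slash_levi => //.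
  exact: shear_dualP.
exact: slice_space.
Qed.

Lemma Im_inversion t : complex.Im (- t^-1) = complex.Im t / normc t ^+ 2.
Proof.
case: t => u v /=; rewrite sqr_sqrtr; last by rewrite addr_ge0 ?sqr_ge0.
by rewrite opprK.
Qed.

Lemma jacobi_inversion M l m t : Sp_int M -> 0 < complex.Im t ->
  normc (jacobi_value (M *m first_inversion n) l m t) =
  normc t ^- 2 * normc (jacobi_value M (- m) l (- t^-1)).
Proof.
move=> SpM t0; have tn0 : t != 0.
  by apply: contraTneq t0 => ->; rewrite /= ltxx.
have nt0 : 0 < normc t.
  by rewrite lt_def normc_ge0 andbT; apply: contra tn0 => /eqP/eq0_normc ->.
have -> : normc t ^- 2 = normc (t ^- 2) by rewrite normcV normcX.
have SpS := first_inversion_Sp n.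
have t10 : 0 < complex.Im (- t^-1) by rewrite Im_inversion divr_gt0// exprn_gt0.
have X0s : (- (l^T *m m) - m^T *m l)^T = - (l^T *m m) - m^T *m l.
  by rewrite tr_addmx !tr_oppmx !trmx_mul !trmxK addrC.
apply: (@jacobi_transfer _ _ l m t _ _ _ _ _ (Sp_int_mul SpM SpS) SpM t0 t10 X0s).
move=> X Xs; have Ht := slice_space l m Xs t0.
rewrite addrA -slice_inversion// slice_block; apply: slash_first_inversion => //.
by rewrite -slice_block.
Qed.

End FourierJacobi.

Lemma exists_expr_ge (R : realType) (x y : R) : 1 < x -> exists N : nat, y <= x ^+ N.
Proof.
move=> x1; pose e := x - 1; have e0 : 0 < e by rewrite subr_gt0.
have bern (m : nat) : 1 + m%:R * e <= x ^+ m.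
  elim: m => [|m IH]; first by rewrite mul0r addr0 expr0.
  rewrite exprS -natr1; have := ler0n R m; move: IH.
  rewrite (_ : x = 1 + e); last by rewrite /e; ring.
  by move: (m%:R) ((1 + e) ^+ m) => a b; nra.
exists (Num.truncn (`|y| / e)).+1; apply: le_trans (bern _).
have : `|y| / e < (Num.truncn (`|y| / e)).+1%:R by rewrite truncnS_gt.
rewrite ltr_pdivrMr// => h; have := ler_norm y; lra.
Qed.

Lemma inversion_gain (R : realType) (h : R) (t : R[i]) (k : int) : 0 < complex.Im t ->
  complex.Im t < h -> `|complex.Re t + k%:~R| <= 1 / 2 ->
  complex.Im t * (1 / 4 + h ^+ 2)^-1 <= complex.Im (- (t + k%:~R)^-1).
Proof.
move=> t0 th tk; rewrite Im_inversion Im_translate; apply: ler_wpM2l; first exact: ltW.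
have -> : t + k%:~R = (complex.Re t + k%:~R) +i* complex.Im t.
  have -> : (k%:~R : R[i]) = (k%:~R)%:C by rewrite rmorph_int.
  by case: t {t0 th tk} => u v /=; apply/eqP; rewrite eq_complex/= addr0 !eqxx.
move: tk t0 th; rewrite /normc ler_norml => /andP[].
move: (_ + k%:~R) (complex.Im t) => u v u1 u2 v0 vh.
have uv0 : 0 < u ^+ 2 + v ^+ 2 by rewrite ltr_wpDl ?sqr_ge0// exprn_gt0.
rewrite sqr_sqrtr; last exact: ltW.
have d0 : 0 < 1 / 4 + h ^+ 2 by have := sqr_ge0 h; lra.
by rewrite lef_pV2 ?posrE// lerD//; nra.
Qed.

Opaque Sp_int siegel_space slash jacobi_value first_translation first_inversion shear_levi.

Section Boundedness.
Variables (R : realType) (n : nat).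
Local Notation iR := (map_mx (fun z : int => z%:~R : R)).
Local Notation red2 := (map_mx (fun z : int => z%:~R : 'F_2)).
Variable f : 'M[R[i]]_(1 + n) -> R[i].
Variable a : 'M[int]_((1 + n) + (1 + n)) -> 'M[R]_(1 + n) -> R[i].
Hypothesis fmod : modular_form_Gamma2 2 f.
Hypothesis aF : forall M, Sp_int M -> fourier_expansion (slash 2 M f) (a M).
Hypothesis aP : forall M T, Sp_int M -> a M T != 0 -> posdef T.
Implicit Types (M : 'M[int]_((1 + n) + (1 + n))) (l m : 'rV[R]_n) (t : R[i])
  (T : 'M[R]_(1 + n)).

Lemma coef_congr M N : Sp_int M -> Sp_int N -> red2 M = red2 N -> a M = a N.
Proof.
move=> SpM SpN MN; apply: (fourier_unique _ (fourier_expansion_family (aF SpM))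
  (fourier_expansion_family (aF SpN))) => tau Ht.
exact: slash_congr fmod SpM SpN MN Ht.
Qed.

Variable T' : 'M[R]_n.
Hypothesis T'half : half_integral T'.

Definition height M l m t : R := complex.Im t * normc (jacobi_value a T' M l m t).

Lemma height_ge0 M l m t : 0 < complex.Im t -> 0 <= height M l m t.
Proof. by move=> t0; rewrite mulr_ge0 ?normc_ge0 ?ltW. Qed.

Lemma height_translation M l m t k : Sp_int M -> 0 < complex.Im t ->
  height (M *m first_translation n k) l m t = height M l (m - k%:~R *: l) (t + k%:~R).
Proof. by move=> SpM t0; rewrite /height Im_translate (jacobi_translation aF T'half l m k SpM t0). Qed.

Lemma height_shear M l m t k : Sp_int M -> 0 < complex.Im t ->
  height (M *m shear_levi k) l m t = height M (l + iR k) m t.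
Proof.
move=> SpM t0.
exact: (congr1 (fun x => complex.Im t * x) (jacobi_shear aF T'half l m k SpM t0)).
Qed.

Lemma height_inversion M l m t : Sp_int M -> 0 < complex.Im t ->
  height (M *m first_inversion n) l m t = height M (- m) l (- t^-1).
Proof.
by move=> SpM t0; rewrite /height Im_inversion (jacobi_inversion aF T'half l m SpM t0) mulrA.
Qed.

Definition integral_multiple (q : nat) l := forall j, q%:R * l 0 j \is a Num.int.

Definition equivalent_point M l m t M' l' m' t' :=
  [/\ Sp_int M', height M' l' m' t' = height M l m t &
    forall q, integral_multiple q l -> integral_multiple q m ->
      integral_multiple q l' /\ integral_multiple q m'].

Lemma equivalent_point_trans M l m t M1 l1 m1 t1 M2 l2 m2 t2 :
  equivalent_point M l m t M1 l1 m1 t1 -> equivalent_point M1 l1 m1 t1 M2 l2 m2 t2 ->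
  equivalent_point M l m t M2 l2 m2 t2.
Proof.
move=> [_ e1 i1] [Sp2 e2 i2]; split; [exact: Sp2 | exact (eq_trans e2 e1) |].
by move=> q ql qm; have [ql1 qm1] := i1 q ql qm; exact: i2.
Qed.

Lemma translate_point M l m t k : Sp_int M -> 0 < complex.Im t ->
  equivalent_point M l m t (M *m first_translation n (- k)) l (m - k%:~R *: l) (t + k%:~R).
Proof.
move=> SpM t0; have SpMk := Sp_int_mul SpM (first_translation_Sp n (- k)).
have tk0 : 0 < complex.Im (t + k%:~R) by rewrite Im_translate.
split; first exact: SpMk.
  rewrite (height_translation _ _ _ SpM tk0) !mulrNz scaleNr opprK subrK.
  by rewrite addrK.
move=> q ql qm; split; first exact: ql.
move=> j; have -> : q%:R * (m - k%:~R *: l) 0 j = q%:R * m 0 j - k%:~R * (q%:R * l 0 j).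
  by rewrite !mxE; ring.
apply: rpredB; first exact: qm.
by apply: rpredM; [exact: intr_int | exact: ql].
Qed.

Lemma invert_point M l m t : Sp_int M -> 0 < complex.Im t ->
  equivalent_point M l m t (M *m first_inversion n) m (- l) (- t^-1).
Proof.
move=> SpM t0; have SpMS := Sp_int_mul SpM (first_inversion_Sp n).
have ti0 : 0 < complex.Im (- t^-1).
  rewrite Im_inversion divr_gt0// exprn_gt0// lt_def normc_ge0 andbT.
  by apply: contraTneq t0 => /eq0_normc ->; rewrite /= ltxx.
split; first exact: SpMS.
  rewrite (height_inversion _ _ SpM ti0) opprK.
  by congr height; rewrite invrN invrK opprK.
by move=> q ql qm; split=> j; [exact: qm | rewrite mxE mulrN rpredN; exact: ql].
Qed.

Lemma raise_point (h : R) M l m t : 0 < h -> h ^+ 2 < 3 / 4 -> Sp_int M -> 0 < complex.Im t ->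
  exists M' l' m' t', equivalent_point M l m t M' l' m' t' /\ h <= complex.Im t'.
Proof.
move=> h0 h34; pose rho := (1 / 4 + h ^+ 2)^-1.
have d0 : 0 < 1 / 4 + h ^+ 2 by have := sqr_ge0 h; lra.
have rho1 : 1 < rho by rewrite invf_gt1//; lra.
suff ind (N : nat) : forall M l m t, Sp_int M -> 0 < complex.Im t ->
    h <= complex.Im t * rho ^+ N ->
    exists M' l' m' t', equivalent_point M l m t M' l' m' t' /\ h <= complex.Im t'.
  move=> SpM t0; have [N hN] := exists_expr_ge (h / complex.Im t) rho1.
  by apply: (ind N); [exact: SpM | exact: t0 | rewrite -ler_pdivrMl// mulrC].
have equiv_refl M1 l1 m1 t1 : Sp_int M1 -> equivalent_point M1 l1 m1 t1 M1 l1 m1 t1 by [].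
elim: N => {M l m t} [|N IH] M l m t SpM t0.
  by rewrite expr0 mulr1 => ht; exists M, l, m, t; split; [exact: equiv_refl | exact: ht].
have [ht _|ht hN] := lerP h (complex.Im t).
  by exists M, l, m, t; split; [exact: equiv_refl | exact: ht].
have [k hk] := near_integer (complex.Re t).
have E1 := translate_point l m k SpM t0.
have t10 : 0 < complex.Im (t + k%:~R) by rewrite Im_translate.
have [Sp1 _ _] := E1.
have E2 := invert_point l (m - k%:~R *: l) Sp1 t10.
have gain : complex.Im t * rho <= complex.Im (- (t + k%:~R)^-1).
  exact: inversion_gain.
have t20 : 0 < complex.Im (- (t + k%:~R)^-1).
  apply: lt_le_trans gain; apply: mulr_gt0; first exact: t0.
  by rewrite invr_gt0.
have [Sp2 _ _] := E2.
have [|M' [l' [m' [t' [E3 ht']]]]] := IH _ (m - k%:~R *: l) (- l) _ Sp2 t20.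
  apply: (le_trans hN); rewrite exprS mulrA; apply: ler_wpM2r; last exact: gain.
  by apply: exprn_ge0; rewrite invr_ge0; exact: ltW.
exists M', l', m', t'; split; last exact: ht'.
exact: (equivalent_point_trans E1 (equivalent_point_trans E2 E3)).
Qed.

Lemma reduce_shear M l m t : Sp_int M -> 0 < complex.Im t ->
  exists M' l', [/\ Sp_int M', height M' l' m t = height M l m t &
    forall j, 0 <= l' 0 j <= 1].
Proof.
move=> SpM t0; pose k : 'rV[int]_n := \row_j Num.floor (l 0 j).
exists (M *m shear_levi k), (l - iR k); split.
- exact: (Sp_int_mul SpM (shear_levi_Sp k)).
- by rewrite (height_shear _ _ _ SpM t0) subrK.
move=> j; rewrite !mxE; have := floor_le (l 0 j); have := floorD1_gt (l 0 j).
by rewrite intrD; move: ((Num.floor _)%:~R) => b; lra.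
Qed.

Lemma fiber_uniform_bound l m t : 0 < complex.Im t ->
  exists C, forall M, Sp_int M -> abs_bounded (on_fiber T' (slice_term a M l m t)) C.
Proof.
move=> t0.
have /choice[C hC] (x : 'M['F_2]_((1 + n) + (1 + n))) : exists C : R, 0 <= C /\ forall M,
    Sp_int M -> red2 M = x -> abs_bounded (on_fiber T' (slice_term a M l m t)) C.
  have [[M [SpM Mx]]|nM] := pselect (exists M, Sp_int M /\ red2 M = x); last first.
    by exists 0; split => // M SpM Mx; case: nM; exists M.
  have [B hB] := fiber_bounded aF T' l m SpM t0.
  exists B; split; first exact: abs_bounded_ge0 hB.
  move=> N SpN Nx F; have := hB F; rewrite /slice_term.
  by rewrite (coef_congr SpM SpN)// Mx Nx.
exists (\sum_x C x) => M SpM F; have [_ /(_ M SpM erefl F) h] := hC (red2 M).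
rewrite (le_trans h)// (bigD1 (red2 M))//= lerDl sumr_ge0// => x _.
by case: (hC x).
Qed.

Lemma affine_form_lower T l : posdef T -> (forall j, 0 <= l 0 j <= 1) ->
  affine_form T 0 / 2 - \sum_i \sum_j `|drsubmx T i j| <= affine_form T l.
Proof.
move=> Tp l01; have [Ts _] := Tp.
pose b : 'rV[R]_(1 + n) := row_mx 0 l.
have q2 (x y : 'rV[R]_(1 + n)) : qform T (x - y) <= 2 * qform T x + 2 * qform T y.
  have : qform T (x - y) + qform T (x + y) = 2 * qform T x + 2 * qform T y.
    rewrite /qform !(mulmxDl, mulmxBl) !tr_addmx !tr_oppmx !(mulmxDr, mulmxBr) !mulmxN !mulNmx.
    move: (x *m T *m x^T) (x *m T *m y^T) (y *m T *m x^T) (y *m T *m y^T) => A B C D.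
    by rewrite !mxE; ring.
  by have := qform_ge0 (x + y) Tp; lra.
have := q2 (affine_row l) b.
have -> : affine_row l - b = affine_row 0.
  by rewrite /affine_row /b opp_row_mx add_row_mx subrr oppr0 addr0.
have bK : qform T b <= \sum_i \sum_j `|drsubmx T i j|.
  have -> : qform T b = \sum_i \sum_j l 0 j * drsubmx T j i * l 0 i.
    rewrite /qform /b -{1}(submxK T) mul_row_block !mul0mx !add0r tr_row_mx mul_row_col trmx0.
    rewrite mulmx0 add0r mxE; apply: eq_bigr => i _; rewrite !mxE mulr_suml.
    by apply: eq_bigr => j _; rewrite !mxE.
  rewrite [leRHS]exchange_big/=; apply: ler_sum => i _; apply: ler_sum => j _.
  apply: (le_trans (ler_norm _)); rewrite !normrM.
  have nl k : `|l 0 k| <= 1 by have /andP[l0 l1] := l01 k; rewrite ger0_norm.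
  rewrite -[leRHS]mulr1 ler_pM ?mulr_ge0// -[leRHS]mul1r ler_pM//.
rewrite /affine_form -!/(qform _ _); move: bK (qform_ge0 b Tp).
by move: (qform _ _) (qform _ _) (qform _ _) (\sum_i _) => x y z w; lra.
Qed.

Variable delta : R.
Hypothesis delta0 : 0 < delta.
Hypothesis delta_le : forall M T, Sp_int M -> a M T != 0 -> drsubmx T = T' ->
  forall l, delta <= affine_form T l.

Lemma height_bounded : exists C, forall M l m t, Sp_int M -> 0 < complex.Im t ->
  height M l m t <= C.
Proof.
pose h : R := 1 / 2; have h0 : 0 < h by rewrite /h; lra.
pose v0 := h / 2; have v00 : 0 < complex.Im (0 +i* v0 : R[i]) by rewrite /= /v0; lra.
have [C hC] := fiber_uniform_bound 0 0 v00.
pose K := \sum_i \sum_j `|T' i j|.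
pose E := expR (pi * h * K).
have pd0 : 0 < pi * delta by rewrite mulr_gt0 ?pi_gt0.
exists (C * E * (h + (pi * delta)^-1)) => M0 l0 m0 t0 SpM0 t00.
have h34 : h ^+ 2 < 3 / 4 by rewrite /h; lra.
have [M1 [l1 [m1 [t [[SpM1 <- _] ht]]]]] := raise_point l0 m0 h0 h34 SpM0 t00.
have tp : 0 < complex.Im t by apply: lt_le_trans ht.
have [M [l [SpM <- l01]]] := reduce_shear l1 m1 SpM1 tp.
rewrite /height; set v := complex.Im t in ht tp *.
have C0 : 0 <= C by apply: abs_bounded_ge0 (hC M SpM).
have bd : abs_bounded (on_fiber T' (slice_term a M l m1 t)) (C * E * expR (- (pi * delta * (v - h)))).
  move=> F; rewrite -mulrA; apply: (le_trans _ (ler_wpM2r _ (hC M SpM F))); last first.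
    by rewrite mulr_ge0 ?expR_ge0.
  rewrite mulr_suml; apply: ler_sum => T _; rewrite /on_fiber.
  case: eqP => [TT'|_]; last by rewrite normc0 mul0r.
  rewrite !normc_slice_term /=.
  have [->|aT] := eqVneq (a M T) 0; first by rewrite normc0 !mul0r.
  rewrite -[leRHS]mulrA; apply: ler_wpM2l; first exact: normc_ge0.
  rewrite /E -!expRD ler_expR -/v.
  have d1 := delta_le SpM aT TT' l; have := affine_form_lower (aP SpM aT) l01.
  rewrite TT' -/K /v0; move: (affine_form T l) (affine_form T 0) d1 => x y d1 xy.
  have : delta * (v - h) <= x * (v - h) by rewrite ler_wpM2r// subr_ge0.
  have : h * (y / 2 - K) <= h * x by rewrite ler_wpM2l// ltW.
  move=> k1 k2.
  have k3 : h * (y / 2 - K) + delta * (v - h) <= v * x by lra.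
  have := ler_wpM2l (pi_ge0 R) k3; lra.
have := has_sum_le bd (jacobi_has_sum aF T' l m1 SpM tp).
move=> /(ler_wpM2l (ltW tp)) /le_trans; apply.
rewrite mulrCA ler_wpM2l ?mulr_ge0 ?expR_ge0//.
set s := pi * delta * (v - h); have s0 : 0 <= s by rewrite mulr_ge0 ?subr_ge0// ltW.
have -> : v = h + s / (pi * delta) by rewrite /s mulrAC mulfV ?gt_eqF// mul1r; ring.
rewrite mulrDl lerD//.
  by rewrite ger_pMr// -expR0 ler_expR oppr_le0.
rewrite mulrAC -[leRHS]mul1r ler_wpM2r ?invr_ge0 ?(ltW pd0)//.
rewrite expRN ler_pdivrMr ?expR_gt0// mul1r.
by have := expR_ge1Dx s; lra.
Qed.

End Boundedness.

Section JacobiMax.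
Variables (R : realType) (n : nat).
Variable f : 'M[R[i]]_(1 + n) -> R[i].
Variable a : 'M[int]_((1 + n) + (1 + n)) -> 'M[R]_(1 + n) -> R[i].
Hypothesis aF : forall M, Sp_int M -> fourier_expansion (slash 2 M f) (a M).
Implicit Types (M : 'M[int]_((1 + n) + (1 + n))) (l m : 'rV[R]_n) (t w : R[i])
  (T : 'M[R]_(1 + n)).

Lemma slice_term_shift M l m t w T : slice_term a M l m (t + w) T =
  slice_term a M l m t T * cexp ((0 +i* pi) * (w * (affine_form T l)%:C)).
Proof.
rewrite /slice_term mulrDl mulrDr cexpD.
by move: (cexp _) (cexp _) (ee _) => x y z; ring.
Qed.

Lemma slice_term_real M l m t (x : R) T : slice_term a M l m (t + x%:C) T =
  slice_term a M l m t T * ee (x * affine_form T l).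
Proof.
rewrite slice_term_shift; congr (_ * cexp _).
by apply/eqP; rewrite eq_complex/=; apply/andP; split; apply/eqP; ring.
Qed.

Lemma slice_term_imag M l m t (y : R) T : slice_term a M l m (t + (0 +i* y)) T =
  slice_term a M l m t T * (expR (- (pi * (y * affine_form T l))))%:C.
Proof.
rewrite slice_term_shift -cexp_real; congr (_ * cexp _).
by apply/eqP; rewrite eq_complex/=; apply/andP; split; apply/eqP; ring.
Qed.

Lemma affine_form0 T : affine_form T 0 = T 0 0.
Proof.
rewrite /affine_form /affine_row -{1}(submxK T) mul_row_block !mul1mx !mul0mx !addr0.
rewrite tr_row_mx mul_row_col trmx0 mulmx0 addr0 trmx1 mulmx1.
by rewrite !mxE; congr (T _ _); apply: val_inj.
Qed.

Lemma affine_form_expand T l : T^T = T ->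
  affine_form T l = T 0 0 + mixed_form T l + qform (drsubmx T) l.
Proof.
move=> Ts; have -> : T 0 0 = ulsubmx T 0 0.
  by rewrite !mxE; congr (T _ _); apply: val_inj.
rewrite /affine_form /mixed_form /qform /affine_row -{1}(submxK T).
rewrite mul_row_block tr_row_mx mul_row_col trmx1 !mulmx1 !mul1mx mulmxDl.
have -> : l *m dlsubmx T = (ursubmx T *m l^T)^T by rewrite trmx_mul trmxK trmx_ursub Ts.
move: (ulsubmx T) (ursubmx T *m l^T) (l *m drsubmx T *m l^T) => A B C.
by rewrite !mxE; ring.
Qed.

Variable T' : 'M[R]_n.
Variable delta : R.
Hypothesis delta0 : 0 < delta.
Hypothesis delta_le : forall M T, Sp_int M -> a M T != 0 -> drsubmx T = T' ->
  forall l, delta <= affine_form T l.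

Lemma discrete_exponents M l (q : nat) : Sp_int M -> (0 < q)%N -> integral_multiple q l ->
  exists (s : R) (k : 'M[R]_(1 + n) -> nat), delta <= s /\
    forall T, a M T != 0 -> drsubmx T = T' -> affine_form T l = s + (k T)%:R / q%:R.
Proof.
move=> SpM q0 ql; have qR : 0 < q%:R :> R by rewrite ltr0n.
pose u := qform T' l; pose b := Num.ceil (q%:R * (delta - u)).
have hb : q%:R * (delta - u) <= b%:~R by exact: ceil_ge.
exists (u + b%:~R / q%:R), (fun T => `|(Num.floor (q%:R * (affine_form T l - u)) - b)%R|%N).
split; first by rewrite -lerBlDl ler_pdivlMr// mulrC.
move=> T aT TT'; have [/(_ _ aT)[Ts Tii Tij] _] := aF SpM.
have /intrP[z zE] : q%:R * (affine_form T l - u) \is a Num.int.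
  rewrite affine_form_expand// TT' -/u addrK mulrDr rpredD//.
    by apply: rpredM; [exact: rpred_nat | exact: Tii].
  rewrite /mixed_form mxE mulr_sumr mulr_sumr rpred_sum// => j _; rewrite !mxE.
  rewrite (_ : q%:R * _ = (2 * T (lshift n 0) (rshift 1 j)) * (q%:R * l 0 j)); last by ring.
  by apply: rpredM; [exact: Tij | exact: ql].
have bz : b <= z.
  rewrite /b ceil_le_int -zE ler_wpM2l ?ler0n// lerB//.
  exact: delta_le SpM aT TT' l.
rewrite zE intrKfloor natr_absz ger0_norm ?subr_ge0// intrB -zE; field.
by rewrite gt_eqF.
Qed.

Lemma jacobi_max M l m t (q : nat) (e S : R) : Sp_int M -> (0 < q)%N -> integral_multiple q l ->
  0 < e -> e < complex.Im t ->
  (forall x : R, normc (jacobi_value a T' M l m (t + (0 +i* - e) + x%:C)) <= S) ->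
  normc (jacobi_value a T' M l m t) <= expR (- (pi * (e * delta))) * S.
Proof.
move=> SpM q0 ql e0 et hS; have qR : 0 < q%:R :> R by rewrite ltr0n.
pose t1 := t + (0 +i* - e).
have t10 : 0 < complex.Im t1 by rewrite /t1; case: (t) et => u v /=; rewrite subr_gt0.
have t0 : 0 < complex.Im t by apply: lt_trans et.
have [s [k [ds kE]]] := discrete_exponents SpM q0 ql.
pose c := on_fiber T' (slice_term a M l m t1).
have cE T : c T != 0 -> [/\ a M T != 0, drsubmx T = T' & c T = slice_term a M l m t1 T].
  rewrite /c /on_fiber; case: ifP => [/eqP TT'|_]; last by rewrite eqxx.
  by rewrite /slice_term mulf_eq0 negb_or => /andP[].
have [B cB] := fiber_bounded aF T' l m SpM t10.
have shiftE x T : on_fiber T' (slice_term a M l m (t1 + x%:C)) T = c T * ee (x * affine_form T l).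
  by rewrite /c /on_fiber; case: eqP => _; [exact: slice_term_real | rewrite mul0r].
have tE : t = t1 + (0 +i* e).
  by rewrite /t1; case: (t) => u v; apply/eqP; rewrite eq_complex/= !addr0 subrK !eqxx.
have upE T : on_fiber T' (slice_term a M l m t) T =
    c T * (expR (- (pi * (e * affine_form T l))))%:C.
  rewrite /c /on_fiber; case: eqP => _; last by rewrite mul0r.
  by rewrite {1}tE; exact: slice_term_imag.
apply/ler_addgt0Pl => eta eta0; pose eta' := eta / 2; have eta'0 : 0 < eta' by rewrite divr_gt0.
have [F0 hF0] := abs_bounded_tail cB eta'0.
have [F1 hF1] := jacobi_has_sum aF T' l m SpM t0 eta'0.
pose F := (F0 `|` F1)%fset.
have PF x : normc (\sum_(T <- F) c T * ee (x * affine_form T l)) <= S + eta'.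
  have tx0 : 0 < complex.Im (t1 + x%:C) by case: (t1) t10 => u v /=; rewrite addr0.
  have hs := jacobi_has_sum aF T' l m SpM tx0.
  have nE T : normc (on_fiber T' (slice_term a M l m (t1 + x%:C)) T) = normc (c T).
    by rewrite shiftE normcM normc_ee mulr1.
  have bx : abs_bounded (on_fiber T' (slice_term a M l m (t1 + x%:C))) B.
    by apply: abs_boundedW cB => T; rewrite nE.
  have tail : forall G : {fset _}, \sum_(T <- G | T \notin F0)
      normc (on_fiber T' (slice_term a M l m (t1 + x%:C)) T) <= eta'.
    by move=> G; under eq_bigr do rewrite nE; exact: hF0.
  have := has_sum_tail bx hs eta'0 tail (fsubsetUl F0 F1).
  under eq_bigr do rewrite shiftE.
  move=> hd; have := hS x; rewrite -/t1 => hx.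
  set P := \sum_(T <- _) _ in hd *; set J := jacobi_value _ _ _ _ _ _ in hd hx.
  rewrite -(subrK J P) (le_trans (le_normcD _ _))// normcB addrC.
  exact: lerD.
pose p : {poly R[i]} := \sum_(T <- F) c T *: 'X^(k T).
have pE z : p.[z] = \sum_(T <- F) c T * z ^+ k T.
  by rewrite /p horner_sum; apply: eq_bigr => T _; rewrite hornerZ hornerXn.
have pS (j N : nat) : (0 < N)%N -> normc p.[ee (2 * j%:R / N%:R)] <= S + eta'.
  move=> N0; pose x : R := q%:R * (2 * j%:R / N%:R).
  have -> : p.[ee (2 * j%:R / N%:R)] = ee (- (x * s)) * \sum_(T <- F) c T * ee (x * affine_form T l).
    rewrite pE mulr_sumr; apply: eq_bigr => T _.
    have [->|/cE[aT TT' _]] := eqVneq (c T) 0; first by rewrite !mul0r mulr0.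
    rewrite mulrCA -eeD -eeMn (kE _ aT TT'); congr (_ * ee _).
    rewrite /x mulrDr addKr; field.
    by rewrite !pnatr_eq0 -!lt0n q0 N0.
  by rewrite normcM normc_ee mul1r PF.
pose rho := expR (- (pi * e / q%:R)).
have rho01 : 0 <= rho <= 1.
  rewrite expR_ge0/= -expR0 ler_expR oppr_le0 divr_ge0// mulr_ge0 ?pi_ge0//; exact: ltW.
have := poly_max pS rho01.
have -> : p.[rho%:C] = (expR (pi * (e * s)))%:C *
    \sum_(T <- F) on_fiber T' (slice_term a M l m t) T.
  rewrite pE mulr_sumr; apply: eq_bigr => T _; rewrite upE.
  have [->|/cE[aT TT' _]] := eqVneq (c T) 0; first by rewrite !mul0r mulr0.
  rewrite mulrCA -real_complexM -expRD (kE _ aT TT') -rmorphXn/= -expRM_natl.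
  congr (_ * (expR _)%:C); rewrite mulr_natl; field.
  by rewrite gt_eqF.
rewrite normcM normc_real gtr0_norm ?expR_gt0// -ler_pdivlMl ?expR_gt0// -expRN.
set P := \sum_(T <- F) _ => hP.
have hPs : normc P <= expR (- (pi * (e * delta))) * (S + eta').
  apply: (le_trans hP); rewrite ler_wpM2r//; first exact: le_trans (normc_ge0 _) (pS 0%N 1%N isT).
  by rewrite ler_expR lerN2 ler_wpM2l ?pi_ge0// ler_wpM2l// ltW.
have hJ := hF1 _ (fsubsetUr F0 F1).
rewrite -(subrK P (jacobi_value _ _ _ _ _ _)) (le_trans (le_normcD _ _))// normcB.
have E1 : expR (- (pi * (e * delta))) * eta' <= eta'.
  by rewrite ger_pMl// -expR0 ler_expR oppr_le0 mulr_ge0 ?pi_ge0// mulr_ge0// ltW.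
move: hJ hPs E1; rewrite -/F -/P mulrDr /eta'; move: (normc _) (normc _) => x y.
move: (expR _ * S) (expR _ * (eta / 2)) => z1 z2; lra.
Qed.

End JacobiMax.

(** * Vanishing of the Fourier coefficients *)

Section Vanishing.
Variables (R : realType) (n : nat).
Local Notation iR := (map_mx (fun z : int => z%:~R : R)).
Local Notation red2 := (map_mx (fun z : int => z%:~R : 'F_2)).
Variable f : 'M[R[i]]_(1 + n) -> R[i].
Variable a : 'M[int]_((1 + n) + (1 + n)) -> 'M[R]_(1 + n) -> R[i].
Hypothesis fmod : modular_form_Gamma2 2 f.
Hypothesis aF : forall M, Sp_int M -> fourier_expansion (slash 2 M f) (a M).
Hypothesis aP : forall M T, Sp_int M -> a M T != 0 -> posdef T.
Implicit Types (M : 'M[int]_((1 + n) + (1 + n))) (l m : 'rV[R]_n) (t : R[i])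
  (T : 'M[R]_(1 + n)).

Lemma qform_levi k (U V : 'M[int]_k) (T : 'M[R]_k) x : U^T *m V = 1%:M ->
  qform (iR V *m T *m (iR V)^T) (x *m (iR U)^T) = qform T x.
Proof.
move=> UV; have UVr : (iR U)^T *m iR V = 1%:M.
  by rewrite map_trmx -int_rowM UV map_mx1.
have VUr : (iR V)^T *m iR U = 1%:M by rewrite -[LHS]trmxK trmx_mul trmxK UVr trmx1.
rewrite /qform trmx_mul trmxK !mulmxA -(mulmxA x) UVr mulmx1.
by rewrite -(mulmxA _ _ (iR U)) VUr mulmx1.
Qed.

Lemma coef_levi M (U V : 'M[int]_(1 + n)) T : Sp_int M -> U^T *m V = 1%:M ->
  a (M *m levi_mx U V) ((iR U)^T *m T *m iR U) = a M T.
Proof.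
move=> SpM UV; have SpL := levi_Sp UV.
have UVr : (iR U)^T *m iR V = 1%:M by rewrite map_trmx -int_rowM UV map_mx1.
have VUr : (iR V)^T *m iR U = 1%:M by rewrite -[LHS]trmxK trmx_mul trmxK UVr trmx1.
have UVr' : iR U *m (iR V)^T = 1%:M by apply: mulmx1C.
have VUr' : iR V *m (iR U)^T = 1%:M by apply: mulmx1C.
pose b S := a M (iR V *m S *m (iR V)^T).
have bK S : iR V *m ((iR U)^T *m S *m iR U) *m (iR V)^T = S.
  by rewrite !mulmxA VUr' mul1mx -mulmxA UVr' mulmx1.
have bK' S : (iR U)^T *m (iR V *m S *m (iR V)^T) *m iR U = S.
  by rewrite !mulmxA UVr mul1mx -mulmxA VUr mulmx1.
suff -> : a (M *m levi_mx U V) = b by rewrite /b bK.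
have [ha hs] := fourier_expansion_family (aF SpM).
apply: (fourier_unique (h' := slash 2 (M *m levi_mx U V) f) (fun _ _ => erefl)
  (fourier_expansion_family (aF (Sp_int_mul SpM SpL)))).
split=> [S /ha hS|tau Ht].
  have [Ss _ _] := hS; apply: qform_half_integral.
    by rewrite -(bK' S) 2!trmx_mul trmxK Ss mulmxA.
  move=> x; have := half_integral_qform hS (x *m U^T).
  by rewrite int_rowM -map_trmx qform_levi.
have HT : @siegel_space R (1 + n) (mx_int_to_C R U *m tau *m (mx_int_to_C R U)^T).
  exact: (levi_space UV Ht).
rewrite (slash_levi f SpM UV Ht); have := hs _ HT.
move=> /(has_sum_bij (f := fun S => iR V *m S *m (iR V)^T) bK' bK).
congr has_sum; apply/funext => S /=; rewrite /b; congr (_ * cexp (_ * _)).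
have iCE p q (A : 'M[int]_(p, q)) : mx_int_to_C R A = map_mx (real_complex R) (iR A).
  by apply/matrixP => i j; rewrite !mxE rmorph_int.
rewrite -[in RHS](bK' S) iCE; move: (iR V *m S *m (iR V)^T) => W.
rewrite (map_mxM _ ((iR U)^T *m W)) (map_mxM _ (iR U)^T) -map_trmx.
by rewrite [in LHS]mulmxA mxtrace_mulC !mulmxA.
Qed.

Variable T' : 'M[R]_n.
Hypothesis T'half : half_integral T'.

Lemma fiber_determined T (S : 'M[R]_(1 + n)) : half_integral T -> half_integral S ->
  drsubmx T = T' -> drsubmx S = T' -> (forall i, T 0 i = S 0 i) -> T = S.
Proof.
move=> [Ts _ _] [Ss _ _] TT' ST' h.
have e (i : 'I_1) : lshift n i = 0 by apply: val_inj; rewrite /= ord1.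
rewrite -[T]submxK -[S]submxK TT' ST'.
have ur : ursubmx T = ursubmx S by apply/matrixP => i j; rewrite !mxE (e i) h.
have ul : ulsubmx T = ulsubmx S by apply/matrixP => i j; rewrite !mxE (e i) h.
have dl : dlsubmx T = dlsubmx S by rewrite -Ts -Ss -!trmx_ursub ur.
by rewrite ur ul dl.
Qed.

Lemma coef_bessel M (v S : R) (F : {fset 'M[R]_(1 + n)}) : Sp_int M -> 0 < v ->
  (forall (u : R) m q, (0 < q)%N -> integral_multiple q m ->
    normc (jacobi_value a T' M 0 m (u +i* v)) <= S) ->
  \sum_(T <- F) normc (on_fiber T' (slice_term a M 0 0 (0 +i* v)) T) ^+ 2 <= S ^+ 2.
Proof.
move=> SpM v0 hS.
have v0' : 0 < complex.Im (0 +i* v : R[i]) by [].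
have [B cB] := fiber_bounded aF T' 0 0 SpM v0'.
set c := on_fiber _ _ in cB *.
pose p T : {ffun 'I_(1 + n) -> int} :=
  [ffun i => Num.floor ((if i == 0 then 1 else 2) * T 0 i)].
have cint T : c T != 0 -> half_integral T /\ drsubmx T = T'.
  rewrite /c /on_fiber; case: ifP => [/eqP TT'|_]; last by rewrite eqxx.
  rewrite /slice_term mulf_eq0 negb_or => /andP[aT _]; split => //.
  by have [h _] := aF SpM; exact: h.
have pE T i : half_integral T -> (p T i)%:~R = (if i == 0 then 1 else 2) * T 0 i.
  move=> [_ h1 h2]; rewrite ffunE floorK//; case: eqP => [->|_]; last exact: h2.
  by rewrite mul1r; exact: h1.
apply: (fiber_bessel (p := p) cB) => [x [q q0 qx]|T1 T2 /cint[h1 e1] /cint[h2 e2] pp].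
  pose m : 'rV[R]_n := \row_j x (rshift 1 j); pose u := x 0.
  exists (jacobi_value a T' M 0 m (u +i* v)); last first.
    by apply: (hS u m q q0) => j; rewrite mxE; exact: qx.
  have uv0 : 0 < complex.Im (u +i* v : R[i]) by [].
  have := jacobi_has_sum aF T' 0 m SpM uv0; congr has_sum; apply/funext => T.
  have [a0|aT] := eqVneq (a M T) 0.
    by rewrite /c /on_fiber /slice_term a0 !mul0r; case: eqP; rewrite mul0r.
  have hT : half_integral T by have [h _] := aF SpM; exact: h.
  rewrite /c /on_fiber; case: eqP => _; last by rewrite mul0r.
  have -> : (u +i* v : R[i]) = (0 +i* v) + u%:C.
    by apply/eqP; rewrite eq_complex/= add0r addr0 !eqxx.
  rewrite slice_term_real.
  have -> : \sum_i (p T i)%:~R * x i = mixed_form T m + u * affine_form T 0.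
    rewrite big_split_ord/= big_ord1 addrC affine_form0; congr (_ + _).
      rewrite /mixed_form mxE mulr_sumr; apply: eq_bigr => j _; rewrite !mxE pE//=.
      by rewrite mulrA; congr (_ * T _ _ * _); apply: val_inj.
    have -> : lshift n (0 : 'I_1) = 0 by apply: val_inj.
    by rewrite pE// eqxx mul1r mulrC.
  rewrite eeD mulrA; congr (_ * _).
  have m0 : mixed_form T 0 = 0 by rewrite /mixed_form trmx0 mulmx0 mxE mulr0.
  rewrite /slice_term m0 ee0.
  by move: (cexp _) (ee _) => y z; ring.
apply: (fiber_determined h1 h2 e1 e2) => i.
apply: (@mulfI R (if i == 0 then 1 else 2)).
  by case: ifP; rewrite ?oner_eq0 ?pnatr_eq0.
by rewrite -(pE T1 i h1) -(pE T2 i h2) pp.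
Qed.

Variable delta : R.
Hypothesis delta0 : 0 < delta.
Hypothesis delta_le : forall M T, Sp_int M -> a M T != 0 -> drsubmx T = T' ->
  forall l, delta <= affine_form T l.

Lemma heights_vanish (q : nat) : 25 / 64 <= delta -> (0 < q)%N ->
  forall M l m t, Sp_int M -> integral_multiple q l -> integral_multiple q m ->
  0 < complex.Im t -> height a T' M l m t <= 0.
Proof.
move=> d25 q0.
have [C hC] := height_bounded fmod aF aP T'half delta0 delta_le.
pose E := [set x | exists M l m t, [/\ Sp_int M, integral_multiple q l,
  integral_multiple q m, 0 < complex.Im t & x = height a T' M l m t]]%classic.
have int0 : integral_multiple q (0 : 'rV[R]_n).
  by move=> j; rewrite mxE mulr0 int_num0.
have E0 : E (height a T' 1%:M 0 0 'i%C).
  exists 1%:M, 0, 0, 'i%C; split; [|exact: int0|exact: int0|by rewrite /= ltr01|by []].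
  have := @levi_Sp (1 + n) 1%:M 1%:M; rewrite /levi_mx -scalar_mx_block trmx1 mulmx1.
  exact.
have hE : has_sup E.
  split; first by exists (height a T' 1%:M 0 0 'i%C).
  by exists C => _ [M [l [m [t [SpM _ _ t0 ->]]]]]; exact: hC.
have ubE x : E x -> x <= sup E by move=> Ex; apply: ub_le_sup => //; case: hE.
have S0 : 0 <= sup E by apply: le_trans (ubE _ E0); apply: height_ge0; rewrite /= ltr01.
pose h : R := 433 / 500; pose e : R := 1 / 160; pose theta : R := 1 - 1 / (140 * 140).
have key M l m t : Sp_int M -> integral_multiple q l -> integral_multiple q m ->
    0 < complex.Im t -> height a T' M l m t <= theta * sup E.
  move=> SpM0 ql0 qm0 t00.
  have h0 : 0 < h by rewrite /h; lra.
  have h34 : h ^+ 2 < 3 / 4 by rewrite /h; lra.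
  have [M1 [l1 [m1 [t1 [[SpM <- int1] ht]]]]] := raise_point aF T'half l m h0 h34 SpM0 t00.
  have [ql qm] := int1 q ql0 qm0.
  move: M1 l1 m1 t1 SpM ql qm ht {int1 SpM0 ql0 qm0 t00} => {}M {}l {}m {}t SpM ql qm ht.
  have e0 : 0 < e by rewrite /e; lra.
  have et : e < complex.Im t by move: ht; rewrite /h /e; lra.
  have ve : 0 < complex.Im t - e by rewrite subr_gt0.
  have bd (x : R) : normc (jacobi_value a T' M l m (t + (0 +i* - e) + x%:C)) <=
      sup E / (complex.Im t - e).
    rewrite ler_pdivlMr// mulrC; set t' := _ + x%:C.
    have It : complex.Im t' = complex.Im t - e by rewrite /t'; case: (t) => u v /=; rewrite addr0.
    rewrite -It; apply: ubE; exists M, l, m, t'; split; [exact: SpM|exact: ql|exact: qm| |by []].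
    by rewrite It.
  have := jacobi_max aF delta0 delta_le SpM q0 ql e0 et bd.
  move=> /(ler_wpM2l (ltW (lt_trans e0 et))) /le_trans; apply.
  have pd : 75 / 64 <= pi * delta.
    have := pi_ge3 R => p3; have : 3 * (25 / 64) <= pi * delta by apply: ler_pM => //; lra.
    by lra.
  have ex : expR (- (pi * (e * delta))) <= (1 + 75 / 64 * e)^-1.
    rewrite expRN lef_pV2 ?posrE ?expR_gt0//; last by rewrite /e; lra.
    apply: le_trans (expR_ge1Dx _); rewrite lerD2l.
    have -> : pi * (e * delta) = e * (pi * delta) by ring.
    by rewrite [leLHS]mulrC; apply: ler_wpM2l; [exact: ltW | exact: pd].
  have d0 : 0 < 1 + 75 / 64 * e by rewrite /e; lra.
  have fr : complex.Im t * ((1 + 75 / 64 * e)^-1 * (complex.Im t - e)^-1) <= theta.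
    rewrite -invfM ler_pdivrMr ?mulr_gt0//; move: ht; rewrite /theta /e /h; lra.
  have iv0 : 0 <= (complex.Im t - e)^-1 by rewrite invr_ge0; exact: ltW.
  have v0 : 0 <= complex.Im t by apply: ltW; exact: lt_trans et.
  have h1 := le_trans (ler_wpM2l v0 (ler_wpM2r iv0 ex)) fr.
  by apply: le_trans (ler_wpM2r S0 h1); rewrite le_eqVlt; apply/orP; left; apply/eqP; ring.
have : sup E <= theta * sup E.
  by apply: ge_sup => [|_ [M [l [m [t [SpM ql qm t0 ->]]]]]]; [case: hE | exact: key].
move=> hS M l m t SpM ql qm t0; apply: le_trans (key M l m t SpM ql qm t0) _.
by move: hS S0; rewrite /theta; lra.
Qed.

Lemma coef_vanish_small M T : 25 / 64 <= delta -> Sp_int M -> drsubmx T = T' -> a M T = 0.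
Proof.
move=> d25 SpM TT'; have bd (u : R) m q : (0 < q)%N -> integral_multiple q m ->
    normc (jacobi_value a T' M 0 m (u +i* 1)) <= 0.
  move=> q0 qm; have int0 : integral_multiple q (0 : 'rV[R]_n).
    by move=> j; rewrite mxE mulr0 int_num0.
  have t0 : 0 < complex.Im (u +i* 1 : R[i]) by rewrite /= ltr01.
  by have := heights_vanish d25 q0 SpM int0 qm t0; rewrite /height /= mul1r.
have := coef_bessel [fset T]%fset SpM ltr01 bd.
rewrite big_seq_fset1 /on_fiber TT' eqxx normc_slice_term expr0n /=.
set x := normc _ * _ => hx; have : x ^+ 2 == 0 by rewrite eq_le hx sqr_ge0.
rewrite sqrf_eq0 mulf_eq0 => /orP[/eqP/eq0_normc //|].
by rewrite gt_eqF// expR_gt0.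
Qed.

Lemma coef_shear M T (k : 'rV[int]_n) : Sp_int M ->
  a (M *m shear_levi k) ((iR (shear k))^T *m T *m iR (shear k)) = a M T.
Proof. by move=> SpM; exact: (coef_levi T SpM (shear_dualP k)). Qed.

Lemma shear_levi_red2 M (k : 'rV[int]_n) : (forall j, red2 k 0 j = 0) ->
  red2 (M *m shear_levi k) = red2 M.
Proof.
move=> k0; have k0' : red2 k = 0 by apply/rowP => j; rewrite (k0 j) mxE.
rewrite map_mxM /=; suff -> : red2 (shear_levi k) = 1%:M by rewrite mulmx1.
have E1 : red2 (shear k) = 1%:M.
  rewrite /shear map_block_mx !map_mx1 map_mx0 -map_trmx k0' trmx0.
  by rewrite -scalar_mx_block.
have E2 : red2 (shear_dual k) = 1%:M.
  rewrite /shear_dual map_block_mx !map_mx1 map_mx0 map_mxN k0' oppr0.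
  by rewrite -scalar_mx_block.
Transparent shear_levi.
rewrite /shear_levi /levi_mx map_block_mx !map_mx0 E1 E2.
by rewrite -scalar_mx_block.
Opaque shear_levi.
Qed.

Lemma shear_blocks T (k : 'rV[int]_n) : T^T = T ->
  drsubmx ((iR (shear k))^T *m T *m iR (shear k)) = drsubmx T /\
  ursubmx ((iR (shear k))^T *m T *m iR (shear k)) = ursubmx T + iR k *m drsubmx T /\
  affine_form ((iR (shear k))^T *m T *m iR (shear k)) 0 = affine_form T (iR k).
Proof.
move=> Ts; have E : iR (shear k) = block_mx 1%:M 0 (iR k)^T 1%:M.
  by rewrite /shear map_block_mx !map_mx1 map_mx0 map_trmx.
rewrite E tr_block_mx !trmx1 trmx0 trmxK -{1 3}[T]submxK !mulmx_block.
rewrite !block_mxKdr !block_mxKur !mul0mx !mul1mx !mulmx0 !mulmx1 !add0r.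
split=> //; split=> //; rewrite /affine_form /affine_row; congr (_ 0 0).
pose W : 'M[R]_(1 + n) := block_mx 1%:M (iR k) 0 1%:M.
have e : row_mx 1%:M 0 *m W = row_mx 1%:M (iR k).
  by rewrite /W mul_row_block !mulmx1 mul1mx mul0mx !addr0.
have -> : block_mx 1%:M 0 (iR k)^T 1%:M = W^T.
  by rewrite /W tr_block_mx !trmx1 trmx0.
by rewrite -/W !mulmxA e -mulmxA -trmx_mul e.
Qed.

Lemma coef_vanish_large M T : (5 <= n)%N -> Sp_int M -> drsubmx T = T' -> a M T = 0.
Proof.
move=> n5 SpM TT'; have [//|aT] := eqVneq (a M T) 0; exfalso.
have [C hC] := height_bounded fmod aF aP T'half delta0 delta_le.
have [Ts Tpos] := aP SpM aT.
pose K := 4 * \sum_i \sum_j `|T i j|.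
pose A := normc (a M T) ^+ 2 * expR (- (2 * pi * K)).
have A0 : 0 < A.
  rewrite mulr_gt0 ?expR_gt0// exprn_gt0// lt_def normc_ge0 andbT.
  by apply: contra aT => /eqP/eq0_normc ->.
suff bound (N : nat) : (0 < N)%N -> N%:R * A <= C ^+ 2.
  have := bound (Num.truncn (C ^+ 2 / A)).+1 isT.
  by rewrite leNgt -ltr_pdivrMr// truncnS_gt.
move=> N0; have NR : 0 < N%:R :> R by rewrite ltr0n.
pose k (x : {ffun 'I_n -> 'I_N}) : 'rV[int]_n := \row_j (2 * Posz (x j)).
pose Tk x := (iR (shear (k x)))^T *m T *m iR (shear (k x)).
have kred x : a (M *m shear_levi (k x)) = a M.
  apply: (coef_congr fmod aF (Sp_int_mul SpM (shear_levi_Sp _)) SpM).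
  by apply: shear_levi_red2 => j; rewrite !mxE intrM (_ : 2%:~R = 0) ?mul0r//; apply: val_inj.
have aTk x : a M (Tk x) = a M T by rewrite -[in LHS](kred x) coef_shear.
have Tkinj : injective Tk.
  move=> x y xy; have [_ [ux _]] := shear_blocks (k x) Ts.
  have [_ [uy _]] := shear_blocks (k y) Ts.
  have : (iR (k x) - iR (k y)) *m T' = 0.
    rewrite mulmxBl -TT'; apply/eqP; rewrite subr_eq0; apply/eqP.
    by apply: (@addrI _ (ursubmx T)); rewrite -ux -uy -!/(Tk _) xy.
  move=> dT; have d0 : iR (k x) - iR (k y) = 0.
    apply/eqP/negPn/negP => d0; have := Tpos (row_mx 0 (iR (k x) - iR (k y))).
    have -> : (row_mx 0 (iR (k x) - iR (k y)) != 0 :> 'rV[R]_(1 + n)).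
      apply: contra d0 => /eqP/(congr1 rsubmx); rewrite row_mxKr => ->.
      by apply/eqP/rowP => j; rewrite !mxE.
    move=> /(_ isT); rewrite -{1}[T]submxK mul_row_block !mul0mx !add0r TT' dT.
    by rewrite tr_row_mx mul_row_col trmx0 mulmx0 mul0mx addr0 mxE ltxx.
  apply/ffunP => j; apply: val_inj.
  move/rowP/(_ j): d0; rewrite !mxE => /eqP; rewrite subr_eq0 eqr_int => /eqP.
  by move=> /(@mulfI int 2 isT) [].
pose v : R := (N%:R ^+ 2)^-1; have v0 : 0 < v by rewrite invr_gt0 exprn_gt0.
have bd (u : R) m q : (0 < q)%N -> integral_multiple q m ->
    normc (jacobi_value a T' M 0 m (u +i* v)) <= C / v.
  move=> _ _; rewrite ler_pdivlMr// mulrC.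
  by apply: (hC M 0 m (u +i* v)).
have := coef_bessel [fset Tk x | x in {: {ffun 'I_n -> 'I_N}}]%fset SpM v0 bd.
rewrite big_imfset/=; last by move=> x y _ _; exact: Tkinj.
have aff x : affine_form (Tk x) 0 <= K * N%:R ^+ 2.
  have [_ [_ ->]] := shear_blocks (k x) Ts; rewrite /affine_form.
  have wN j : `|affine_row (iR (k x)) 0 j| <= 2 * N%:R.
    have N1 : 1 <= N%:R :> R by rewrite ler1n.
    rewrite /affine_row mxE; case: splitP => i _; rewrite !mxE.
      by rewrite ord1 eqxx normr1; lra.
    by rewrite intrM normrM !ger0_norm// ler_wpM2l// ler_nat ltnW.
  move: (affine_row _) wN => w wN; rewrite mxE /K exchange_big/= mulrAC mulr_sumr; apply: ler_sum => i _.
  rewrite !mxE mulr_suml mulr_sumr; apply: ler_sum => j _.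
  apply: (le_trans (ler_norm _)); rewrite !normrM.
  rewrite (_ : 4 * N%:R ^+ 2 * `|T j i| = (2 * N%:R) * `|T j i| * (2 * N%:R)); last by ring.
  by rewrite ler_pM ?mulr_ge0// ler_wpM2r.
move=> hb; have : \sum_(x : {ffun 'I_n -> 'I_N}) A <= (C / v) ^+ 2.
  apply: le_trans hb; rewrite big_enum/=; apply: ler_sum => x _.
  rewrite /on_fiber; have [-> _] := shear_blocks (k x) Ts; rewrite TT' eqxx.
  rewrite normc_slice_term aTk exprMn /A ler_wpM2l ?sqr_ge0// -expRM_natl ler_expR.
  rewrite mulrN lerN2 -mulrA; apply: ler_wpM2l => //; apply: ler_wpM2l; first exact: pi_ge0.
  by rewrite /v mulrC ler_pdivrMr ?exprn_gt0.
rewrite sumr_const card_ffun !card_ord => hN.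
have N5 : N%:R ^+ 5 * A <= A *+ (N ^ n)%N.
  by rewrite -[leRHS]mulr_natl natrX ler_wpM2r ?(ltW A0)// ler_weXn2l// ler1n.
have {}hN := le_trans N5 hN.
rewrite -(ler_pM2l (exprn_gt0 4 NR)) mulrA -exprSr; apply: (le_trans hN).
by rewrite /v invrK exprMn -exprM mulrC.
Qed.

End Vanishing.

Transparent Sp_int siegel_space slash jacobi_value first_translation first_inversion shear_levi.

Section Minimality.
Variables (R : realType).
Local Notation iR := (map_mx (fun z : int => z%:~R : R)).

Lemma posdef_drsub n (T : 'M[R]_(1 + n)) : posdef T -> posdef (drsubmx T).
Proof.
move=> [Ts Tp]; split=> [|v v0]; first by rewrite trmx_drsub Ts.
have := Tp (row_mx 0 v); rewrite row_mx_eq0 eqxx (negPf v0) => /(_ isT).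
rewrite -{1}[T]submxK mul_row_block !mul0mx !add0r.
by rewrite tr_row_mx mul_row_col trmx0 mulmx0 add0r.
Qed.

Lemma posdef_unit n (T : 'M[R]_n) : posdef T -> T \in unitmx.
Proof.
move=> [_ Tp]; rewrite -row_free_unit; apply: inj_row_free => v v0.
have [//|/Tp] := eqVneq v 0.
by rewrite v0 mul0mx mxE ltxx.
Qed.

(* Completing the square: [D] is the Schur complement of the lower right block. *)
Lemma posdef_schur n (T : 'M[R]_(1 + n)) : posdef T -> exists D : R,
  [/\ 0 < D, \det T = D * \det (drsubmx T), exists l, affine_form T l = D
    & forall l, D <= affine_form T l].
Proof.
move=> Tp; have [Ts Tpos] := Tp; have T'p := posdef_drsub Tp; have [T's _] := T'p.
have uT' := posdef_unit T'p.
pose b := ursubmx T; pose l0 := - (b *m invmx (drsubmx T)).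
have l0T : l0 *m drsubmx T = - b by rewrite mulNmx mulmxKV.
pose D := ulsubmx T + b *m l0^T.
have dlE : dlsubmx T = b^T by rewrite trmx_ursub Ts.
have T00 : T 0 0 = ulsubmx T 0 0 by rewrite !mxE; congr (T _ _); apply: val_inj.
have aff y : affine_form T (l0 + y) = D 0 0 + qform (drsubmx T) y.
  rewrite (affine_form_expand _ Ts) /mixed_form /qform -/b T00 /D.
  have -> : (l0 + y) *m drsubmx T *m (l0 + y)^T =
      - (b *m l0^T) - b *m y^T - (b *m y^T)^T + y *m drsubmx T *m y^T.
    rewrite tr_addmx mulmxDl l0T mulmxDl !mulmxDr !mulNmx; set z := y *m _ *m l0^T.
    have -> : z = - (b *m y^T)^T.
      by rewrite /z -mulmxA -{1}T's -trmx_mul l0T tr_oppmx mulmxN trmx_mul trmxK.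
    by rewrite !addrA.
  rewrite tr_addmx mulmxDr.
  move: (ulsubmx T) (b *m l0^T) (b *m y^T) (y *m drsubmx T *m y^T) => A B E F.
  by rewrite !mxE; ring.
have aff0 : affine_form T l0 = D 0 0.
  have := aff 0; have -> : qform (drsubmx T) 0 = 0 by rewrite /qform !mul0mx mxE.
  by rewrite !addr0.
exists (D 0 0); split; last 2 first.
- by exists l0.
- move=> l; have -> : l = l0 + (l - l0) by rewrite addrC subrK.
  by rewrite aff lerDl qform_ge0.
- rewrite -aff0; apply: Tpos.
  by rewrite /affine_row row_mx_eq0 oner_eq0.
- pose W := block_mx 1%:M l0 0 1%:M : 'M[R]_(1 + n).
  have dW : \det W = 1 by rewrite det_ublock !det1 mulr1.
  rewrite -[LHS]mul1r -dW -det_mulmx -{1}[T]submxK mulmx_block.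
  rewrite !mul1mx !mul0mx !add0r l0T subrr det_lblock; congr (_ * _).
  rewrite det_mx11 /D dlE; congr (fun_of_matrix (_ + _) _ _).
  by rewrite -[RHS]trmxK trmx_mul trmxK; apply/matrixP => i j; rewrite [RHS]mxE !ord1.
Qed.

Lemma posdef_det_gt0 n (T : 'M[R]_n) : posdef T -> 0 < \det T.
Proof.
elim: n T => [|n IH] T Tp; first by rewrite det_mx00.
have [D [D0 dT _ _]] := @posdef_schur n T Tp.
by rewrite dT mulr_gt0// IH//; apply: posdef_drsub.
Qed.

Lemma half_integral_det n (T : 'M[R]_n) : half_integral T -> posdef T ->
  exists2 k : nat, (0 < k)%N & 2 ^+ n * \det T = k%:R.
Proof.
move=> [Ts Td To] Tp; have d0 : 0 < 2 ^+ n * \det T.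
  by rewrite mulr_gt0 ?exprn_gt0// posdef_det_gt0.
have dE : 2 ^+ n * \det T = (\det (\matrix_(i, j) Num.floor (2 * T i j)))%:~R.
  rewrite -detZ -det_map_mx; congr (\det _); apply/matrixP => i j.
  by rewrite !mxE /= floorK.
move: d0; rewrite dE ltr0z; case: (\det _) => // k k0.
by exists k.
Qed.

Lemma det_congr n (U V : 'M[int]_n) (T : 'M[R]_n) : U^T *m V = 1%:M ->
  \det ((iR U)^T *m T *m iR U) = \det T.
Proof.
move=> UV; have VU : V^T *m U = 1%:M by rewrite -[LHS]trmxK trmx_mul trmxK UV trmx1.
rewrite !det_mulmx det_tr det_map_mx mulrAC -expr2 -rmorphXn /=.
by rewrite (int_det_sqr VU) mul1r.
Qed.

Lemma reduce_first_row n (T : 'M[R]_(1 + n)) : (n < 5)%N -> half_integral T -> posdef T ->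
  exists U V : 'M[int]_(1 + n), U^T *m V = 1%:M /\
    forall l, 25 / 64 <= affine_form ((iR U)^T *m T *m iR U) l.
Proof.
move=> n5 Th Tp; have Tint := half_integral_qform Th.
have rat : rational_form T by exists 1%N => // x; rewrite mul1r; apply: Tint.
have T1 (x : 'rV[int]_(1 + n)) : x != 0 -> 1 <= qform T (iR x).
  move=> x0; have [_ /(_ (iR x))] := Tp; rewrite int_row_eq0 => /(_ x0).
  by rewrite -/(qform T (iR x)); have /intrP[z ->] := Tint x; rewrite ltr0z ler1z.
have [l [w [wl hl]]] := reducible_le5 n5 Tp rat ltr01 T1.
have [|U0 uU0 rU0] := @complete_primitive n l^T.
  move=> c r lr; apply/unitrP; exists ((r *m w^T) 0 0).
  have e : c * (r *m w^T) 0 0 = 1.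
    have wlT : l^T *m w^T = 1%:M by rewrite -trmx_mul wl trmx1.
    by move: wlT; rewrite lr -scalemxAl => /matrixP/(_ 0 0); rewrite mxE => ->; rewrite mxE.
  by rewrite mulrC e.
exists (invmx U0), U0^T; split; first by rewrite -trmx_mul mulmxV// trmx1.
move=> m; pose x := affine_row m *m (iR (invmx U0))^T.
have -> : affine_form ((iR (invmx U0))^T *m T *m iR (invmx U0)) m = qform T x.
  by rewrite /affine_form /qform /x trmx_mul trmxK !mulmxA.
have xl : x *m iR l = 1%:M.
  have -> : iR l = (iR U0)^T *m (row_mx 1%:M 0)^T.
    rewrite -trmx_mul -[l]trmxK -rU0 -map_trmx int_rowM map_row_mx map_mx1 map_mx0.
    by [].
  rewrite /x mulmxA -(mulmxA (affine_row m)) -trmx_mul -int_rowM mulmxV// map_mx1 trmx1 mulmx1.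
  by rewrite tr_row_mx mul_row_col trmx1 trmx0 mulmx1 mulmx0 addr0.
by have := hl x; rewrite xl mxE eqxx expr1n !mulr1.
Qed.

Lemma slash1 g (f : 'M[R[i]]_g -> R[i]) tau : slash 2 1%:M f tau = f tau.
Proof.
rewrite /slash /siegel_act /automorphy_mx /mx_int_to_C.
rewrite scalar_mx_block block_mxKul block_mxKur block_mxKdl block_mxKdr.
by rewrite !map_mx0 !map_mx1 !mul0mx !add0r addr0 mul1mx invmx1 mulmx1 det1 expr1n invr1 mul1r.
Qed.

Lemma Sp_int1 g : Sp_int (1%:M : 'M[int]_(g + g)).
Proof. by rewrite /Sp_int/= trmx1 mul1mx mulmx1. Qed.

End Minimality.

Section NoCuspForm.
Variables (R : realType) (n : nat).
Local Notation iR := (map_mx (fun z : int => z%:~R : R)).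
Variable f : 'M[R[i]]_(1 + n) -> R[i].
Variable a : 'M[int]_((1 + n) + (1 + n)) -> 'M[R]_(1 + n) -> R[i].
Hypothesis fmod : modular_form_Gamma2 2 f.
Hypothesis aF : forall M, Sp_int M -> fourier_expansion (slash 2 M f) (a M).
Hypothesis aP : forall M T, Sp_int M -> a M T != 0 -> posdef T.

Lemma coef_vanish M T : Sp_int M -> a M T = 0.
Proof.
have aH M' S : Sp_int M' -> a M' S != 0 -> half_integral S.
  by move=> /aF[h _]; exact: h.
move=> SpM; apply/eqP; apply: contrapT => /negP aMT.
pose P (k : nat) := `[< exists M S, [/\ Sp_int M, a M S != 0 & 2 ^+ (1 + n) * \det S = k%:R] >].
have Pex : exists k, P k.
  have [k _ kE] := half_integral_det (aH _ _ SpM aMT) (aP SpM aMT).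
  by exists k; apply/asboolP; exists M, T.
case: (ex_minnP Pex) => k /asboolP[M0 [T0 [SpM0 aT0 kE]]] kmin.
have detmin M' S : Sp_int M' -> a M' S != 0 -> \det T0 <= \det S.
  move=> SpM' aS; have [j _ jE] := half_integral_det (aH _ _ SpM' aS) (aP SpM' aS).
  rewrite -(ler_pM2l (exprn_gt0 (1 + n) (ltr0n R 2))) kE jE ler_nat; apply: kmin.
  by apply/asboolP; exists M', S.
have [M1 [T1 [SpM1 aT1 dT1 hT1]]] : exists M1 T1, [/\ Sp_int M1, a M1 T1 != 0,
    \det T1 = \det T0 & (n < 5)%N -> forall l, 25 / 64 <= affine_form T1 l].
  have [n5|n5] := ltnP n 5; last by exists M0, T0.
  have [U [V [UV hU]]] := reduce_first_row n5 (aH _ _ SpM0 aT0) (aP SpM0 aT0).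
  exists (M0 *m levi_mx U V), ((iR U)^T *m T0 *m iR U); split.
  - exact: Sp_int_mul SpM0 (levi_Sp UV).
  - by rewrite (coef_levi aF _ SpM0 UV).
  - exact: det_congr UV.
  - by move=> _.
have T1p := aP SpM1 aT1.
have T'half := half_integral_drsub (aH _ _ SpM1 aT1).
have d'0 := posdef_det_gt0 (posdef_drsub T1p).
have [D [D0 DT Datt _]] := posdef_schur T1p.
have delta_le M' S : Sp_int M' -> a M' S != 0 -> drsubmx S = drsubmx T1 ->
    forall l, D <= affine_form S l.
  move=> SpM' aS SE l; have [D' [_ DS _ Dl']] := posdef_schur (aP SpM' aS).
  apply: le_trans (Dl' l); rewrite -(ler_pM2r d'0) -DT -{1}SE -DS dT1.
  exact: detmin SpM' aS.
move/eqP: aT1; apply; have [n5|n5] := ltnP n 5.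
  have D25 : 25 / 64 <= D by have [l <-] := Datt; exact: hT1.
  exact: (coef_vanish_small fmod aF aP T'half D0 delta_le D25 SpM1 erefl).
exact: (coef_vanish_large fmod aF aP T'half D0 delta_le n5 SpM1 erefl).
Qed.

End NoCuspForm.

Theorem theorem6p3 (R : realType) (g : nat) (hg : (1 <= g)%N) :
  ~ exists f : 'M[complex R]_g -> complex R,
      cusp_form_Gamma2 2 f /\ exists2 tau, siegel_space tau & f tau <> 0%R.
Proof.
case: g hg => // n _ [f [[fmod fcusp] [tau Ht]]]; apply.
have /choice[a ha] M : exists b : 'M[R]_(1 + n) -> R[i], @Sp_int (1 + n) M ->
    fourier_expansion (slash 2 M f) b /\ forall T, b T != 0 -> posdef T.
  have [SpM|nSpM] := pselect (@Sp_int (1 + n) M); last by exists (fun=> 0).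
  by have [b hb] := fcusp M SpM; exists b.
have a0 T : a 1%:M T = 0.
  apply: (@coef_vanish R n f a fmod) => [M /ha[]//|M S /ha[_ h]|]; first exact: h.
  exact: Sp_int1.
have [_ hs] := fourier_expansion_family (proj1 (ha 1%:M (@Sp_int1 (1 + n)))).
have := hs tau Ht; rewrite slash1 => /(has_sum_le (B := 0)) h; apply: eq0_normc.
apply/eqP; rewrite eq_le normc_ge0 andbT; apply: h => F.
by rewrite big1// => T _; rewrite a0 mul0r normc0.
Qed.
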